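(* Let $\lambda\in\mathbb{C}$ with $|\lambda|>1$, let $p$ be a non-constant complex polynomial, and let $L=R_\lambda p(D)$ on $\mathcal{H}(\mathbb{C})$. Then every closed subspace of $\mathcal{H}(\mathbb{C})$ all of whose non-zero vectors are supercyclic for $L$ is finite-dimensional.
   Context: $\mathcal{H}(\mathbb{C})$ is the Fréchet space of entire functions on $\mathbb{C}$ with the compact-open topology; $Df=f'$; $R_\lambda f(z)=f(\lambda z)$. For $p(z)=\sum_{k=0}^d a_kz^k$, $p(D)f=\sum_{k=0}^d a_kf^{(k)}$. A vector $f$ is supercyclic for an operator $T$ if $\{\mu T^nf: n\in\mathbb{N},\ \mu\in\mathbb{C}\}$ is dense. *)

(* Defs.v *)
From HB Require Import structures.
From mathcomp Require Import all_boot all_order all_algebra.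
From mathcomp Require Export complex.
From mathcomp Require Import all_classical all_reals all_analysis.

Set Implicit Arguments.
Unset Strict Implicit.
Unset Printing Implicit Defensive.

Import Order.TTheory GRing.Theory Num.Theory.
Import numFieldNormedType.Exports.
Local Open Scope classical_set_scope.
Local Open Scope ring_scope.

(* The normed C-module structure of C = R[i] given by the modulus. *)
HB.instance Definition _ (R : realType) := NormedModule.copy R[i] R[i]^o.

Definition entire (R : realType) : {pred R[i] -> R[i]} :=
  [pred f : R[i] -> R[i] | `[< forall z : R[i], derivable f z 1 >]].

Lemma entire_submod_closed (R : realType) : submod_closed (@entire R).
Proof.
split=> [|a f g].
  apply/asboolP => z; exact: derivable_cst.
move=> /asboolP fE /asboolP gE; apply/asboolP => z.
by apply: derivableD; [exact: derivableZ|exact: gE].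
Qed.

HB.instance Definition _ (R : realType) :=
  GRing.isSubmodClosed.Build R[i] (R[i] -> R[i]) (@entire R)
    (@entire_submod_closed R).

Record entire_fun (R : realType) : Type := EntireFun {
  entire_val :> R[i] -> R[i];
  entire_valP : entire_val \in @entire R }.

HB.instance Definition _ (R : realType) := [isSub for @entire_val R].
HB.instance Definition _ (R : realType) :=
  [Choice of entire_fun R by <:].
HB.instance Definition _ (R : realType) :=
  [SubChoice_isSubLmodule of entire_fun R by <:].
HB.instance Definition _ (R : realType) :=
  Topological.copy (entire_fun R)
    (initial_topology
      (@entire_val R : entire_fun R -> {compact-open, R[i] -> R[i]})).

Definition diff_poly (R : realType) (p : {poly R[i]})
    (f : R[i] -> R[i]) : R[i] -> R[i] :=
  fun z => \sum_(k < size p) p`_k * derive1n k f z.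

Definition dilation (R : realType) (lambda : R[i])
    (f : R[i] -> R[i]) : R[i] -> R[i] :=
  fun z => f (lambda * z).

(* T acts on all functions, but only its restriction to entire functions
   matters. Since dilation lambda \o diff_poly p maps entire functions to
   entire functions, for such T the set below is the whole projective orbit
   of f. *)
Definition supercyclic (R : realType)
    (T : (R[i] -> R[i]) -> (R[i] -> R[i])) (f : entire_fun R) : Prop :=
  dense [set g : entire_fun R | exists (mu : R[i]) (n : nat),
    forall z, g z = mu * iter n T f z].

Definition linear_subspace (K : pzRingType) (V : lmodType K) (M : set V) : Prop :=
  submod_closed [pred v | v \in M].

Definition finite_dimensional (K : pzRingType) (V : lmodType K) (M : set V) : Prop :=
  exists (n : nat) (e : 'I_n -> V),
    M = [set v | exists c : 'I_n -> K, v = \sum_(i < n) c i *: e i].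

(* Main.v *)
Require Import Defs.
From mathcomp Require Import all_boot all_order all_algebra.
From mathcomp Require Import all_classical all_reals all_analysis.
From mathcomp Require Import ring lra.
Import Order.TTheory GRing.Theory Num.Theory.
Import numFieldNormedType.Exports.
Local Open Scope classical_set_scope.
Local Open Scope ring_scope.

(** Suppose that M is infinite-dimensional.  A non-zero f in M that is not
    supercyclic is built as a series of vectors vanishing to higher and higher
    order at 0.

    For a sequence a of Taylor coefficients and r > 0 let |a|_r be the supremum
    of |a_k| r^k.  If the multiples of the L^n f were dense, some multiple g of
    some L^n f would be close to the constant 1 on the unit square; by the
    Cauchy estimates g - 1 would have small coefficients, so |g_0| would be close
    to |g|_1.  Hence f is not supercyclic as soon as twice |(L^n f)_0| is at most
    |L^n f|_1 for all n ([not_supercyclic_of_small_constant_term]).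

    Vanishing to order N at 0 means the vanishing of finitely many linear
    functionals, so M contains non-zero vectors that vanish to any given order
    ([finite_dimensional_of_functionals]).  On such vectors L^n is large.
    Indeed differentiation multiplies |a|_r by at least N / r when a vanishes to
    order N, so for large N the leading term of p(D) dominates and
    |p(D) a|_r >= c |a|_r with c half the modulus of the leading coefficient.
    Dilation by lambda changes the radius from r to |lambda| r, whence
    |L^n a|_1 >= c^n |a|_(|lambda|^n).  Finally a vector vanishing to order N
    gains a factor 2^N when the radius grows from |lambda|^n / 2 to |lambda|^n,
    and for large N this beats every constant that depends on n only
    ([high_order_dominates]).

    Let r_n = |lambda|^n / 2; as |lambda| > 1, these radii exhaust the plane.
    Choose e_0, e_1, ... in M one after the other with |e_n|_(r_n) = 4^-n and
    e_n vanishing to order N_n, where N_n depends on e_0 + ... + e_(n-1).  The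
    series f of the e_n converges locally uniformly, so f lies in M.  Its tail
    y_n from e_n on satisfies |y_n|_(r_n) >= 4^-n / 2, vanishes to order N_n, and
    so L^n y_n has constant term 0 and dominates L^n (e_0 + ... + e_(n-1)).  The
    constant term of L^n f is therefore small compared with |L^n f|_1
    ([block_series_escapes]).

    All this takes place in the space of rapidly decreasing sequences.  It is
    identified with the space of entire functions by Taylor's theorem
    ([entire_taylor]), proved from differentiability at every point alone:
    Goursat's theorem for rectangles, then Cauchy's formula on squares centred at
    0, then the geometric expansion of the Cauchy kernel. *)

Set Implicit Arguments.
Unset Strict Implicit.
Unset Printing Implicit Defensive.

(** * The modulus as a real number *)

Section Modulus.
Variable R : realType.
Implicit Types (z w : R[i]) (x y : R).

(** The norm of R[i] takes values in R[i], whose order is partial; estimates are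
    carried out in the ordered field R instead. *)
Definition cabs z : R := complex.Re `|z|.

Lemma cabsE z : `|z| = ((cabs z)%:C)%C.
Proof. by rewrite /cabs normc_def. Qed.

Lemma cabs_ge0 z : 0 <= cabs z.
Proof. by rewrite -lecR -cabsE normr_ge0. Qed.

Lemma cabs_eq0 z : (cabs z == 0) = (z == 0).
Proof. by rewrite -(inj_eq (@complexI R)) -cabsE normr_eq0. Qed.

Lemma cabs0 : cabs 0 = 0.
Proof. by apply/eqP; rewrite cabs_eq0. Qed.

Lemma cabs_gt0 z : (0 < cabs z) = (z != 0).
Proof. by rewrite lt0r cabs_ge0 andbT cabs_eq0. Qed.

Lemma cabs1 : cabs 1 = 1.
Proof. by apply: complexI; rewrite -cabsE normr1. Qed.

Lemma cabsM z w : cabs (z * w) = cabs z * cabs w.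
Proof. by apply: complexI; rewrite rmorphM/= -!cabsE normrM. Qed.

Lemma cabsV z : cabs z^-1 = (cabs z)^-1.
Proof. by apply: complexI; rewrite fmorphV/= -!cabsE normfV. Qed.

Lemma cabsX z n : cabs (z ^+ n) = cabs z ^+ n.
Proof. by apply: complexI; rewrite rmorphXn/= -!cabsE normrX. Qed.

Lemma cabsN z : cabs (- z) = cabs z.
Proof. by apply: complexI; rewrite -!cabsE normrN. Qed.

Lemma cabs_distC z w : cabs (z - w) = cabs (w - z).
Proof. by rewrite -cabsN opprB. Qed.

Lemma cabsD z w : cabs (z + w) <= cabs z + cabs w.
Proof. by rewrite -lecR rmorphD/= -!cabsE ler_normD. Qed.

Lemma cabsB z w : cabs (z - w) <= cabs z + cabs w.
Proof. by rewrite -(cabsN w) cabsD. Qed.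

Lemma cabs_triangle z w : cabs z - cabs w <= cabs (z - w).
Proof. by rewrite lerBlDr (le_trans _ (cabsD _ _)) // subrK. Qed.

Lemma cabs_sum (I : Type) (s : seq I) (P : pred I) (F : I -> R[i]) :
  cabs (\sum_(i <- s | P i) F i) <= \sum_(i <- s | P i) cabs (F i).
Proof.
elim/big_rec2: _ => [|i x z _ le_zx]; first by rewrite cabs0.
by rewrite (le_trans (cabsD _ _)) // lerD2l.
Qed.

Lemma cabs_real x : cabs (x%:C)%C = `|x|.
Proof. by rewrite /cabs normc_def /= expr0n addr0 sqrtr_sqr. Qed.

Lemma cabs_nat n : cabs n%:R = n%:R.
Proof. by rewrite -(rmorph_nat (real_complex R)) cabs_real ger0_norm. Qed.

Lemma cabs_i : cabs 'i%C = 1.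
Proof. by rewrite /cabs normc_def /= expr0n expr1n add0r sqrtr1. Qed.

Lemma Re_le_cabs z : `|complex.Re z| <= cabs z.
Proof.
by rewrite /cabs normc_def /= -sqrtr_sqr ler_sqrt ?lerDl ?addr_ge0 ?sqr_ge0.
Qed.

Lemma Im_le_cabs z : `|complex.Im z| <= cabs z.
Proof.
by rewrite /cabs normc_def /= -sqrtr_sqr ler_sqrt ?lerDr ?addr_ge0 ?sqr_ge0.
Qed.

Lemma cabs_le_ReIm z : cabs z <= `|complex.Re z| + `|complex.Im z|.
Proof.
rewrite {1}(complexE z) (le_trans (cabsD _ _)) // cabsM cabs_i mul1r.
by rewrite !cabs_real.
Qed.

Lemma ReD z w : complex.Re (z + w) = complex.Re z + complex.Re w.
Proof. by case: z w => [a b] [c d]. Qed.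
Lemma ImD z w : complex.Im (z + w) = complex.Im z + complex.Im w.
Proof. by case: z w => [a b] [c d]. Qed.
Lemma ReM z w : complex.Re (z * w) =
  complex.Re z * complex.Re w - complex.Im z * complex.Im w.
Proof. by case: z w => [a b] [c d]. Qed.
Lemma ImM z w : complex.Im (z * w) =
  complex.Re z * complex.Im w + complex.Im z * complex.Re w.
Proof. by case: z w => [a b] [c d]. Qed.
Lemma ReB z w : complex.Re (z - w) = complex.Re z - complex.Re w.
Proof. by case: z w => [a b] [c d]. Qed.
Lemma ImB z w : complex.Im (z - w) = complex.Im z - complex.Im w.
Proof. by case: z w => [a b] [c d]. Qed.

End Modulus.

(** * Convergent series of complex numbers *)

Section Series.
Variable R : realType.
Implicit Types (u v : nat -> R[i]) (l m z w : R[i]) (C e : R).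

Definition has_sum u l := forall e, 0 < e ->
  exists N, forall n, (N <= n)%N -> cabs (\sum_(k < n) u k - l) <= e.

Lemma cabs_eq0_small z : (forall e, 0 < e -> cabs z <= e) -> z = 0.
Proof.
move=> H; apply/eqP; rewrite -cabs_eq0; case: ltgtP (cabs_ge0 z) => // z0 _.
by have := H (cabs z / 2) ltac:(lra) => ?; exfalso; lra.
Qed.

Lemma has_sum_unique u l m : has_sum u l -> has_sum u m -> l = m.
Proof.
move=> ul um; apply/eqP; rewrite -subr_eq0; apply/eqP.
apply: cabs_eq0_small => e e0.
have [N1 H1] := ul (e / 2) ltac:(lra).
have [N2 H2] := um (e / 2) ltac:(lra).
have {H1} := H1 _ (leq_maxl N1 N2); have {H2} := H2 _ (leq_maxr N1 N2).
set s := \sum_(_ < _) _ => H2 H1.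
rewrite (_ : l - m = (s - m) - (s - l)); last by ring.
by have := cabsB (s - m) (s - l); lra.
Qed.

Lemma has_sum_add u v l m : has_sum u l -> has_sum v m ->
  has_sum (fun k => u k + v k) (l + m).
Proof.
move=> ul vm e e0.
have [N1 H1] := ul (e / 2) ltac:(lra).
have [N2 H2] := vm (e / 2) ltac:(lra).
exists (maxn N1 N2) => n; rewrite geq_max => /andP[/H1 h1 /H2 h2].
rewrite big_split /=.
rewrite (_ : _ - _ = (\sum_(k < n) u k - l) + (\sum_(k < n) v k - m)); last by ring.
by apply: le_trans (cabsD _ _) _; lra.
Qed.

Lemma has_sum_scale u l z : has_sum u l -> has_sum (fun k => z * u k) (z * l).
Proof.
move=> ul e e0; have z0 := cabs_ge0 z.
have [N H] := ul (e / (cabs z + 1)) ltac:(apply: divr_gt0; lra).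
exists N => n /H h; rewrite -mulr_sumr -mulrBr cabsM.
apply: le_trans (ler_wpM2l z0 h) _.
by rewrite mulrA ler_pdivrMr; nra.
Qed.

Lemma has_sum_eq u v l : (forall k, u k = v k) -> has_sum u l -> has_sum v l.
Proof. by move=> /funext ->. Qed.

Lemma has_sum_shift u l : has_sum (fun k => u k.+1) l -> has_sum u (u 0%N + l).
Proof.
move=> ul e /ul[N H]; exists N.+1 => -[//|n]; rewrite ltnS => /H.
by rewrite big_ord_recl /= opprD addrACA subrr add0r.
Qed.

Lemma has_sum_finite u N : (forall k, (N <= k)%N -> u k = 0) ->
  has_sum u (\sum_(k < N) u k).
Proof.
move=> u0 e e0; exists N => n leNn.
rewrite -(subnKC leNn) big_split_ord /= addrAC subrr add0r big1 ?cabs0 ?ltW //.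
by move=> i _; rewrite u0 // leq_addr.
Qed.

Lemma geometric_half_sum n : \sum_(k < n) (2^-1 : R) ^+ k <= 2.
Proof.
suff -> : \sum_(k < n) (2^-1 : R) ^+ k = 2 - 2 * 2^-1 ^+ n.
  by rewrite lerBlDr lerDl mulr_ge0 // exprn_ge0.
elim: n => [|n IH]; first by rewrite big_ord0 expr0; lra.
by rewrite big_ord_recr /= IH exprS; lra.
Qed.

(** Domination by the geometric series of ratio 1/2 serves as the only criterion
    of absolute convergence below. *)
Lemma has_sum_le u l C : (forall k, cabs (u k) <= C * 2^-1 ^+ k) ->
  has_sum u l -> cabs l <= 2 * C.
Proof.
move=> uC ul.
have C0 : 0 <= C by have := uC 0%N; rewrite expr0 mulr1; apply: le_trans (cabs_ge0 _).
apply/ler_addgt0Pr => e e0; have [N /(_ N (leqnn _)) H] := ul _ e0.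
have := cabs_triangle l (\sum_(k < N) u k); rewrite cabs_distC => ?.
suff : cabs (\sum_(k < N) u k) <= 2 * C by lra.
apply: le_trans (cabs_sum _ _ _) _.
apply: le_trans (ler_sum _ (fun (i : 'I_N) _ => uC i)) _.
by rewrite -mulr_sumr mulrC ler_wpM2r // geometric_half_sum.
Qed.

Lemma real_geometric_cvg (a : nat -> R) C : (forall k, `|a k| <= C * 2^-1 ^+ k) ->
  exists x : R, forall e, 0 < e ->
  exists N, forall n, (N <= n)%N -> `|\sum_(k < n) a k - x| <= e.
Proof.
move=> aC.
have : cvgn [normed series a].
  apply: (@series_le_cvg _ _ (geometric C 2^-1)) => //.
  - by move=> n /=; rewrite normr_ge0.
  - by move=> n /=; rewrite (le_trans _ (aC n)) // normr_ge0.
  - by apply: is_cvg_geometric_series; rewrite ger0_norm; lra.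
move=> /normed_cvg cva; exists (limn (series a)) => e e0.
have /cvgrPdist_le /(_ _ e0) [N _ H] := cva.
exists N => n /H; rewrite distrC /series /= big_mkord; exact.
Qed.

Lemma has_sum_exists u C : (forall k, cabs (u k) <= C * 2^-1 ^+ k) ->
  exists l, has_sum u l.
Proof.
move=> uC.
have [x Hx] := @real_geometric_cvg (fun k => complex.Re (u k)) C
  (fun k => le_trans (Re_le_cabs _) (uC k)).
have [y Hy] := @real_geometric_cvg (fun k => complex.Im (u k)) C
  (fun k => le_trans (Im_le_cabs _) (uC k)).
exists (x +i* y)%C => e e0.
have [N1 H1] := Hx (e / 2) ltac:(lra).
have [N2 H2] := Hy (e / 2) ltac:(lra).
exists (maxn N1 N2) => n; rewrite geq_max => /andP[/H1 h1 /H2 h2].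
have ReS : complex.Re (\sum_(k < n) u k) = \sum_(k < n) complex.Re (u k).
  by elim/big_rec2: _ => //= i a b _ <-; rewrite ReD.
have ImS : complex.Im (\sum_(k < n) u k) = \sum_(k < n) complex.Im (u k).
  by elim/big_rec2: _ => //= i a b _ <-; rewrite ImD.
by apply: le_trans (cabs_le_ReIm _) _; rewrite ReB ImB ReS ImS /=; lra.
Qed.

End Series.

(** * Complex differentiability *)

Section Differentiability.
Variable R : realType.
Implicit Types (f g : R[i] -> R[i]) (z w k l : R[i]).

(** Multiplying the difference quotient out lets w = z be included, so that no
    punctured neighbourhood appears in estimates. *)
Definition has_cderiv f z l := forall e : R, 0 < e ->
  exists2 d : R, 0 < d & forall w, cabs (w - z) < d ->
    cabs (f w - f z - l * (w - z)) <= e * cabs (w - z).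

Lemma ltc_cabs z (d : R) : (`|z| < (d%:C)%C) = (cabs z < d).
Proof. by rewrite cabsE ltcR. Qed.

Lemma posc_real (e : R[i]) : 0 < e -> 0 < complex.Re e /\ e = ((complex.Re e)%:C)%C.
Proof.
by case: e => a b; rewrite ltcE /= => /andP[/eqP -> a0]; split.
Qed.

Lemma near_complexP z (P : set R[i]) :
  (\forall w \near z, P w) <->
  exists2 d : R, 0 < d & forall w, cabs (w - z) < d -> P w.
Proof.
split.
  move=> /nbhs_ballP[e /= /posc_real[e0 ->] H]; exists (complex.Re e) => // w wz.
  by apply: H; rewrite /ball /= ltc_cabs cabs_distC.
case=> d d0 H; apply/nbhs_ballP; exists (d%:C)%C; first by rewrite /= ltcR.
by move=> w; rewrite /ball /= ltc_cabs cabs_distC; apply: H.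
Qed.

Lemma near_dcomplexP (P : set R[i]) :
  (\forall h \near (0 : R[i])^', P h) <->
  exists2 d : R, 0 < d & forall h, h != 0 -> cabs h < d -> P h.
Proof.
split.
  by move=> /near_complexP[d d0 H]; exists d => // h h0 hd; apply: H; rewrite ?subr0.
by case=> d d0 H; apply/near_complexP; exists d => // h; rewrite subr0 => *; apply: H.
Qed.

(** The passage between difference quotients and [has_cderiv]. *)
Lemma quotient_error (h l D : R[i]) (e : R) : h != 0 ->
  (cabs (l - h^-1 * D) <= e) = (cabs (D - l * h) <= e * cabs h).
Proof.
move=> h0; rewrite -(ler_pM2r (x := cabs h)) ?cabs_gt0 // -cabsM cabs_distC.
by rewrite mulrBl mulrAC mulVf // mul1r.
Qed.

Lemma derivableP_cderiv f z :
  derivable f z 1 <-> exists l, has_cderiv f z l.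
Proof.
have E h : h != 0 -> h^-1 *: ((f \o shift z) (h *: 1) - f z) = h^-1 * (f (h + z) - f z).
  by move=> _; rewrite /= /shift /= -[h *: 1]/(h * 1) mulr1.
split.
  move=> /cvgrPdist_le /= H; exists ('D_1 f z) => e e0.
  have /near_dcomplexP[d d0 {}H] := H (e%:C)%C ltac:(by rewrite ltcR).
  exists d => // w wd; have [->|wz] := eqVneq w z.
    by rewrite !subrr mulr0 subrr cabs0 mulr0.
  have hz : w - z != 0 by rewrite subr_eq0.
  by have := H _ hz wd; rewrite E // subrK cabsE lecR quotient_error.
case=> l H; apply/cvg_ex; exists l; apply/cvgrPdist_le => /= e /posc_real[e0 ->].
have [d d0 {}H] := H _ e0.
apply/near_dcomplexP; exists d => // h h0 hd.
rewrite E // cabsE lecR quotient_error //.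
by have := H (h + z); rewrite addrK => /(_ hd).
Qed.

Lemma derive1_cderiv f z l : has_cderiv f z l -> derive1 f z = l.
Proof.
move=> H; apply: cvg_lim; first exact: norm_hausdorff.
apply/cvgrPdist_le => /= e /posc_real[e0 ->].
have [d d0 {}H] := H _ e0.
apply/near_dcomplexP; exists d => // h h0 hd.
rewrite cabsE lecR -[_ *: _]/(_ * _) quotient_error //.
by have := H (h + z); rewrite addrK => /(_ hd).
Qed.

Lemma cderivable_cst k z : exists l, has_cderiv (fun=> k) z l.
Proof.
exists 0 => e e0; exists 1 => // v _.
by rewrite subrr mul0r subrr cabs0 mulr_ge0 ?cabs_ge0 ?ltW.
Qed.

Lemma cderivable_mul f g z : (exists l, has_cderiv f z l) ->
  (exists l, has_cderiv g z l) -> exists l, has_cderiv (fun w => f w * g w) z l.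
Proof.
move=> /derivableP_cderiv df /derivableP_cderiv dg; apply/derivableP_cderiv.
have H : derivable (f * g) z 1 := derivableM df dg.
exact: H.
Qed.

Lemma cderivable_inv f z : f z != 0 -> (exists l, has_cderiv f z l) ->
  exists l, has_cderiv (fun w => (f w)^-1) z l.
Proof.
move=> fz /derivableP_cderiv df; apply/derivableP_cderiv.
have H := derivableV fz df; exact: H.
Qed.

Lemma has_cderiv_affine k l z : has_cderiv (fun w => k * w + l) z k.
Proof.
move=> e e0; exists 1 => // w _.
rewrite (_ : _ - _ - _ = 0) ?cabs0; last by ring.
by rewrite mulr_ge0 ?cabs_ge0 // ltW.
Qed.

End Differentiability.

(** * Power series with infinite radius of convergence *)

Section PowerSeries.
Variable R : realType.
Implicit Types (a b : nat -> R[i]) (f g : R[i] -> R[i]) (z w l : R[i]).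

(** By the Cauchy-Hadamard formula, these are the coefficient sequences of the
    power series that converge in the whole plane. *)
Definition rapid a := forall r : R, 0 <= r ->
  exists C, forall k, cabs (a k) * r ^+ k <= C.

Definition pseries_sum a f := forall z, has_sum (fun k => a k * z ^+ k) (f z).

Definition deriv_seq a k := k.+1%:R * a k.+1.

(** Doubling the radius produces the geometric factor that makes the terms
    summable. *)
Lemma rapid_term a (r C : R) k z : 0 <= r ->
  (forall k, cabs (a k) * (2 * r) ^+ k <= C) -> cabs z <= r ->
  cabs (a k * z ^+ k) <= C * 2^-1 ^+ k.
Proof.
move=> r0 aC zr; rewrite cabsM cabsX exprVn ler_pdivlMr ?exprn_gt0 //.
apply: le_trans (aC k); rewrite exprMn mulrAC [_ * 2 ^+ k * _]mulrAC -mulrA [2 ^+ k * _]mulrC.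
rewrite ler_wpM2l ?cabs_ge0 // ler_wpM2r ?exprn_ge0 //.
by rewrite lerXn2r ?nnegrE ?cabs_ge0.
Qed.

Lemma pseries_sum_exists a : rapid a -> exists f, pseries_sum a f.
Proof.
move=> ra; have sum z : exists l, has_sum (fun k => a k * z ^+ k) l.
  have [|C aC] := ra (2 * cabs z); first by rewrite mulr_ge0 ?cabs_ge0.
  by apply: (@has_sum_exists _ _ C) => k; apply: rapid_term (cabs_ge0 z) aC _.
by have [f fP] := choice sum; exists f.
Qed.

Lemma pseries_sum_le a f (r C : R) z : 0 <= r ->
  (forall k, cabs (a k) * (2 * r) ^+ k <= C) -> pseries_sum a f ->
  cabs z <= r -> cabs (f z) <= 2 * C.
Proof.
by move=> r0 aC af zr; apply: has_sum_le (af z) => k; apply: rapid_term aC zr.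
Qed.

Lemma rapid_deriv_seq a : rapid a -> rapid (deriv_seq a).
Proof.
move=> ra r r0; have [C aC] := ra (2 * (r + 1)) ltac:(lra).
exists C => k; apply: le_trans (aC k.+1).
rewrite /deriv_seq cabsM cabs_nat [_ * cabs _]mulrC -mulrA ler_wpM2l ?cabs_ge0 //.
rewrite exprMn ler_pM ?exprn_ge0 //.
  by rewrite -natrX ler_nat ltnW // ltn_expl.
rewrite exprSr (le_trans (y := (r + 1) ^+ k)) //.
  by rewrite lerXn2r ?nnegrE; lra.
by rewrite ler_peMr ?exprn_ge0; lra.
Qed.

(** By induction on k from
    E_(k+1) = (z + h) E_k + h^2 (k+1) z^k for the remainder E_k of the
    power k + 1.  The bound is a geometric sequence in k, so it can be summed
    against rapidly decreasing coefficients. *)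
Lemma binomial_remainder z (h : R[i]) k : cabs h <= 1 ->
  cabs ((z + h) ^+ k.+1 - z ^+ k.+1 - k.+1%:R * z ^+ k * h)
    <= cabs h ^+ 2 * (cabs z + 2) ^+ k.+1.
Proof.
move=> h1; have z0 := cabs_ge0 z; have h0 := cabs_ge0 h.
elim: k => [|k IH].
  rewrite expr0 !expr1 mulr1 mul1r (_ : _ - _ - _ = 0); last by ring.
  by rewrite cabs0 mulr_ge0 ?exprn_ge0 //; lra.
set E := _ - _ in IH.
rewrite (_ : _ - _ = (z + h) * E + h ^+ 2 * (k.+1%:R * z ^+ k)); last first.
  by rewrite /E !exprS -(addn1 k.+1) natrD; ring.
apply: le_trans (cabsD _ _) _; rewrite !cabsM !cabsX cabs_nat.
have H1 : cabs (z + h) * cabs E <= (cabs z + 1) * (cabs h ^+ 2 * (cabs z + 2) ^+ k.+1).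
  by apply: ler_pM => //; rewrite ?cabs_ge0 // (le_trans (cabsD _ _)) // lerD2l.
have H2 : k.+1%:R * cabs z ^+ k <= (cabs z + 2) ^+ k.+1.
  elim: {IH E H1} k => [|k IH]; first by rewrite expr0 expr1; lra.
  rewrite [X in _ <= X]exprS.
  have : cabs z ^+ k.+1 <= (cabs z + 2) ^+ k.+1 by rewrite lerXn2r ?nnegrE; lra.
  have : 0 <= (cabs z + 2) ^+ k.+1 by rewrite exprn_ge0; lra.
  have := ler_wpM2l z0 IH.
  have -> : k.+2%:R = k.+1%:R + 1 :> R by rewrite -natr1.
  rewrite [cabs z ^+ k.+1]exprS; set B := (_ + _) ^+ k.+1; lra.
have := ler_wpM2l (exprn_ge0 2 h0) H2.
rewrite ![_ ^+ k.+2]exprS; move: H1; rewrite -expr2 => H1 H3.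
by apply: le_trans (lerD H1 H3) _; rewrite le_eqVlt; apply/orP; left; apply/eqP; ring.
Qed.

(** Termwise differentiation: the remainders of the single powers add up to
    O(|h|^2). *)
Lemma pseries_cderiv a f g z : rapid a ->
  pseries_sum a f -> pseries_sum (deriv_seq a) g -> has_cderiv f z (g z).
Proof.
move=> ra af dg e e0; have z0 := cabs_ge0 z.
have [C aC] := ra (2 * (cabs z + 2)) ltac:(lra).
have C0 : 0 <= C by have := aC 0%N; rewrite expr0 mulr1; apply: le_trans (cabs_ge0 _).
exists (Num.min 1 (e / (2 * C + 1))).
  by rewrite lt_min ltr01 divr_gt0 //; lra.
move=> w; rewrite lt_min => /andP[w1 we].
set h := w - z in w1 we *; have h0 := cabs_ge0 h.
have -> : w = z + h by rewrite /h addrC subrK.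
have dg' : has_sum (fun k => a k * (k%:R * z ^+ k.-1)) (g z).
  rewrite -[g z]add0r.
  have -> : 0 = a 0%N * (0%:R * z ^+ 0.-1) by rewrite mul0r mulr0.
  apply: (@has_sum_shift _ (fun k => a k * (k%:R * z ^+ k.-1))).
  by apply: has_sum_eq (dg z) => k; rewrite /deriv_seq /=; ring.
have S : has_sum (fun k => a k * ((z + h) ^+ k - z ^+ k - k%:R * z ^+ k.-1 * h))
   (f (z + h) - f z - g z * h).
  have := has_sum_add (has_sum_add (af (z + h)) (has_sum_scale (-1) (af z)))
     (has_sum_scale (- h) dg').
  rewrite (_ : _ + _ + _ = f (z + h) - f z - g z * h); last by ring.
  by apply: has_sum_eq => k; ring.
have : cabs (f (z + h) - f z - g z * h) <= 2 * (cabs h ^+ 2 * C).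
  apply: has_sum_le S => -[|k].
    rewrite !expr0 subrr mul0r mul0r subr0 mulr0 cabs0 mulr1.
    by rewrite mulr_ge0 ?exprn_ge0.
  rewrite cabsM; have B := binomial_remainder z k (ltW w1).
  apply: le_trans (ler_wpM2l (cabs_ge0 _) B) _.
  rewrite mulrCA -mulrA ler_wpM2l ?exprn_ge0 // exprVn ler_pdivlMr ?exprn_gt0 //.
  by apply: le_trans (aC k.+1); rewrite -mulrA -exprMn [(_ + _) * 2]mulrC.
move=> H; apply: le_trans H _.
have : cabs h * (2 * C + 1) <= e by rewrite -ler_pdivlMr ?ltW //; lra.
by rewrite expr2; nra.
Qed.

End PowerSeries.

(** * Integrals of complex-valued functions on segments *)

Section PathIntegral.
Variable R : realType.
Implicit Types (u v : R -> R[i]) (a b c t s : R) (k : R[i]).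

Local Notation mu := (@lebesgue_measure R).

(** Continuity is two-sided at the end points as well, because paths are
    restrictions of functions continuous around the segment; in this form it
    passes to both halves of a segment and back. *)
Definition path_continuous u a b := forall t, a <= t <= b ->
  forall e : R, 0 < e ->
  exists2 d : R, 0 < d & forall s, `|s - t| < d -> cabs (u s - u t) <= e.

Definition path_int u a b : R[i] :=
  ((\int[mu]_(t in `[a, b]) complex.Re (u t)) +i*
   (\int[mu]_(t in `[a, b]) complex.Im (u t)))%C.

Lemma real_cont_integrable (f : R -> R) a b :
  (forall t, a <= t <= b -> forall e : R, 0 < e ->
     exists2 d : R, 0 < d & forall s, `|s - t| < d -> `|f s - f t| <= e) ->
  mu.-integrable `[a, b] (EFin \o f).
Proof.
move=> H; apply: continuous_compact_integrable; first exact: segment_compact.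
apply: continuous_in_subspaceT => t /set_mem; rewrite /= in_itv /= => /H {}H.
apply/cvgrPdist_le => e /H[d d0 Hd]; apply/nbhs_ballP; exists d => //= s.
by rewrite /ball /= distrC => /Hd; rewrite distrC.
Qed.

Lemma integrable_Re u a b : path_continuous u a b ->
  mu.-integrable `[a, b] (EFin \o (fun t => complex.Re (u t))).
Proof.
move=> cu; apply: real_cont_integrable => t /cu {}cu e /cu[d d0 H].
exists d => // s /H; apply: le_trans; rewrite -ReB; exact: Re_le_cabs.
Qed.

Lemma integrable_Im u a b : path_continuous u a b ->
  mu.-integrable `[a, b] (EFin \o (fun t => complex.Im (u t))).
Proof.
move=> cu; apply: real_cont_integrable => t /cu {}cu e /cu[d d0 H].
exists d => // s /H; apply: le_trans; rewrite -ImB; exact: Im_le_cabs.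
Qed.

Lemma eq_path_int u v a b : (forall t, a <= t <= b -> u t = v t) ->
  path_int u a b = path_int v a b.
Proof.
move=> uv; congr (_ +i* _)%C; apply: eq_Rintegral => t /set_mem;
  by rewrite /= in_itv /= => /uv ->.
Qed.

Lemma path_continuousD u v a b : path_continuous u a b ->
  path_continuous v a b -> path_continuous (fun t => u t + v t) a b.
Proof.
move=> cu cv t tab e e0.
have [d1 d10 H1] := cu t tab (e / 2) ltac:(lra).
have [d2 d20 H2] := cv t tab (e / 2) ltac:(lra).
exists (Num.min d1 d2); first by rewrite lt_min d10.
move=> s; rewrite lt_min => /andP[/H1 h1 /H2 h2].
rewrite opprD addrACA; apply: le_trans (cabsD _ _) _; lra.
Qed.

Lemma path_continuousZ k u a b : path_continuous u a b ->
  path_continuous (fun t => k * u t) a b.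
Proof.
move=> cu t tab e e0; have k0 := cabs_ge0 k.
have [d d0 H] := cu t tab (e / (cabs k + 1)) ltac:(apply: divr_gt0; lra).
exists d => // s /H h; rewrite -mulrBr cabsM.
apply: le_trans (ler_wpM2l k0 h) _.
by rewrite mulrA ler_pdivrMr; nra.
Qed.

Lemma path_continuousN u a b : path_continuous u a b ->
  path_continuous (fun t => - u t) a b.
Proof.
move=> /(path_continuousZ (-1)); congr path_continuous.
by apply/funext => t; rewrite mulN1r.
Qed.

Lemma path_continuousB u v a b : path_continuous u a b ->
  path_continuous v a b -> path_continuous (fun t => u t - v t) a b.
Proof. by move=> cu /path_continuousN; apply: path_continuousD. Qed.

Lemma path_intD u v a b : path_continuous u a b -> path_continuous v a b ->
  path_int (fun t => u t + v t) a b = path_int u a b + path_int v a b.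
Proof.
move=> cu cv; rewrite /path_int; apply/eqP; rewrite eq_complex /=.
by apply/andP; split; apply/eqP; (under eq_Rintegral do rewrite ?ReD ?ImD);
  rewrite RintegralD //; (exact: integrable_Re || exact: integrable_Im).
Qed.

Lemma path_intZ k u a b : path_continuous u a b ->
  path_int (fun t => k * u t) a b = k * path_int u a b.
Proof.
move=> cu; have iR := integrable_Re cu; have iI := integrable_Im cu.
have zR x : mu.-integrable `[a, b] (EFin \o (fun t => x * complex.Re (u t))).
  have -> : (fun t => x * complex.Re (u t)) = (fun t => complex.Re ((x%:C)%C * u t)).
    by apply/funext => t; rewrite ReM /= mul0r subr0.
  exact/integrable_Re/path_continuousZ.
have zI x : mu.-integrable `[a, b] (EFin \o (fun t => x * complex.Im (u t))).
  have -> : (fun t => x * complex.Im (u t)) = (fun t => complex.Im ((x%:C)%C * u t)).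
    by apply/funext => t; rewrite ImM /= mul0r addr0.
  exact/integrable_Im/path_continuousZ.
rewrite /path_int; apply/eqP; rewrite eq_complex /= ReM ImM /=.
by apply/andP; split; apply/eqP; (under eq_Rintegral do rewrite ?ReM ?ImM);
  rewrite ?RintegralB ?RintegralD // !RintegralZl.
Qed.

Lemma measure_segment a b : a <= b -> fine (mu `[a, b]) = b - a.
Proof.
move=> ab; rewrite lebesgue_measure_itv /= lte_fin; case: ltgtP ab => //= -> _.
by rewrite subrr.
Qed.

Lemma path_int_cst k a b : a <= b -> path_int (fun=> k) a b = k * ((b - a)%:C)%C.
Proof.
move=> ab; rewrite /path_int !Rintegral_cst // !measure_segment //.
by apply/eqP; rewrite eq_complex /= ReM ImM /= !mulr0 subr0 add0r !eqxx.
Qed.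

Lemma real_int_bound (f : R -> R) a b (M : R) : a <= b ->
  mu.-integrable `[a, b] (EFin \o f) ->
  (forall t, a <= t <= b -> `|f t| <= M) ->
  `|\int[mu]_(t in `[a, b]) f t| <= M * (b - a).
Proof.
move=> ab itf fM; apply: le_trans (le_normr_Rintegral _ _) _ => //.
rewrite -(measure_segment ab) -Rintegral_cst //; apply: le_Rintegral => //.
- by have /integrable_norm := itf.
- by apply: real_cont_integrable => t _ e e0; exists 1 => // s _; rewrite subrr normr0 ltW.
Qed.

(** The factor 2 comes from bounding the real and imaginary parts separately. *)
Lemma path_int_bound u a b (M : R) : a <= b -> path_continuous u a b ->
  (forall t, a <= t <= b -> cabs (u t) <= M) ->
  cabs (path_int u a b) <= 2 * M * (b - a).
Proof.
move=> ab cu uM; apply: le_trans (cabs_le_ReIm _) _ => /=.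
have := real_int_bound ab (integrable_Re cu)
  (fun t tab => le_trans (Re_le_cabs _) (uM t tab)).
have := real_int_bound ab (integrable_Im cu)
  (fun t tab => le_trans (Im_le_cabs _) (uM t tab)).
by lra.
Qed.

Lemma path_int_split u a b c : a <= c <= b -> path_continuous u a b ->
  path_int u a b = path_int u a c + path_int u c b.
Proof.
move=> /andP[ac cb] cu; have iR := integrable_Re cu; have iI := integrable_Im cu.
have S (f : R -> R) : mu.-integrable `[a, b] (EFin \o f) ->
  \int[mu]_(t in `[a, b]) f t =
    \int[mu]_(t in `[a, c]) f t + \int[mu]_(t in `[c, b]) f t.
  move=> itf; have /eqP := Rintegral_itvB itf (x := c) ltac:(by rewrite bnd_simp)
    ltac:(by rewrite bnd_simp).
  rewrite Rintegral_itv_obnd_cbnd; last first.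
    by apply: integrableS itf => //; apply: subset_itvr; rewrite bnd_simp.
  by rewrite subr_eq addrC => /eqP.
by rewrite /path_int (S _ iR) (S _ iI); apply/eqP; rewrite eq_complex /= !eqxx.
Qed.

End PathIntegral.

(** * Contour integrals over rectangles *)

Section RectangleIntegral.
Variable R : realType.
Implicit Types (f g : R[i] -> R[i]) (a b c d x y t : R) (z w l p : R[i]).

Definition ccont f z := forall e : R, 0 < e ->
  exists2 r : R, 0 < r & forall w, cabs (w - z) < r -> cabs (f w - f z) <= e.

Lemma cderiv_cont f z l : has_cderiv f z l -> ccont f z.
Proof.
move=> fl e e0; have l0 := cabs_ge0 l.
have [r r0 H] := fl 1 ltr01.
exists (Num.min r (e / (cabs l + 1))).
  by rewrite lt_min r0 divr_gt0 //; lra.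
move=> w; rewrite lt_min => /andP[/H {}H]; rewrite ltr_pdivlMr; last lra.
move=> we; have -> : f w - f z = (f w - f z - l * (w - z)) + l * (w - z) by ring.
by apply: le_trans (cabsD _ _) _; rewrite cabsM; lra.
Qed.

Definition boundary_cont f a b c d := forall x y,
  a <= x <= b -> c <= y <= d -> [\/ x = a, x = b, y = c | y = d] ->
  ccont f (x +i* y)%C.

(** The integral over the positively oriented boundary of [a, b] x [c, d].
    Opposite sides are paired: then for affine f both integrands are constant. *)
Definition contour_int f a b c d : R[i] :=
  path_int (fun t => f (t +i* c)%C - f (t +i* d)%C) a b +
  'i%C * path_int (fun t => f (b +i* t)%C - f (a +i* t)%C) c d.

Lemma horizontal_path f y a b : (forall t, a <= t <= b -> ccont f (t +i* y)%C) ->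
  path_continuous (fun t => f (t +i* y)%C) a b.
Proof.
move=> cf t tab e e0; have [r r0 H] := cf t tab e e0.
exists r => // s st; apply: H.
rewrite (_ : _ - _ = ((s - t)%:C)%C) ?cabs_real //.
by apply/eqP; rewrite eq_complex /= subrr !eqxx.
Qed.

Lemma vertical_path f x c d : (forall t, c <= t <= d -> ccont f (x +i* t)%C) ->
  path_continuous (fun t => f (x +i* t)%C) c d.
Proof.
move=> cf t tcd e e0; have [r r0 H] := cf t tcd e e0.
exists r => // s st; apply: H.
rewrite (_ : _ - _ = 'i%C * ((s - t)%:C)%C) ?cabsM ?cabs_i ?cabs_real ?mul1r //.
by apply/eqP; rewrite eq_complex /=; apply/andP; split; apply/eqP; ring.
Qed.

Section Edges.
Variables (f : R[i] -> R[i]) (a b c d : R).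
Hypotheses (ab : a <= b) (cd : c <= d) (cf : boundary_cont f a b c d).

Lemma bottom_path : path_continuous (fun t => f (t +i* c)%C) a b.
Proof.
by apply: horizontal_path => t tab; apply: cf; rewrite ?lexx ?tab //; apply: Or43.
Qed.
Lemma top_path : path_continuous (fun t => f (t +i* d)%C) a b.
Proof.
by apply: horizontal_path => t tab; apply: cf; rewrite ?lexx ?andbT ?tab //; apply: Or44.
Qed.
Lemma left_path : path_continuous (fun t => f (a +i* t)%C) c d.
Proof.
by apply: vertical_path => t tab; apply: cf; rewrite ?lexx ?tab //; apply: Or41.
Qed.
Lemma right_path : path_continuous (fun t => f (b +i* t)%C) c d.
Proof.
by apply: vertical_path => t tab; apply: cf; rewrite ?lexx ?andbT ?tab //; apply: Or42.
Qed.
End Edges.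

Lemma contour_int_bound f a b c d (M : R) : a <= b -> c <= d -> boundary_cont f a b c d ->
  (forall x y, a <= x <= b -> c <= y <= d -> [\/ x = a, x = b, y = c | y = d] ->
    cabs (f (x +i* y)%C) <= M) ->
  cabs (contour_int f a b c d) <= 4 * M * ((b - a) + (d - c)).
Proof.
move=> ab cd cf fM.
have H1 : cabs (path_int (fun t => f (t +i* c)%C - f (t +i* d)%C) a b) <= 2 * (2 * M) * (b - a).
  apply: path_int_bound => //.
    by apply: path_continuousB; [exact: bottom_path cf | exact: top_path cf].
  move=> t tab; apply: le_trans (cabsB _ _) _.
  have := fM t c tab ltac:(lra) ltac:(by apply: Or43).
  by have := fM t d tab ltac:(lra) ltac:(by apply: Or44); lra.
have H2 : cabs (path_int (fun t => f (b +i* t)%C - f (a +i* t)%C) c d) <= 2 * (2 * M) * (d - c).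
  apply: path_int_bound => //.
    by apply: path_continuousB; [exact: right_path cf | exact: left_path cf].
  move=> t tab; apply: le_trans (cabsB _ _) _.
  have := fM a t ltac:(lra) tab ltac:(by apply: Or41).
  by have := fM b t ltac:(lra) tab ltac:(by apply: Or42); lra.
by apply: le_trans (cabsD _ _) _; rewrite cabsM cabs_i mul1r; lra.
Qed.

Lemma contour_intD f g a b c d : a <= b -> c <= d ->
  boundary_cont f a b c d -> boundary_cont g a b c d ->
  contour_int (fun z => f z + g z) a b c d = contour_int f a b c d + contour_int g a b c d.
Proof.
move=> ab cd cf cg; rewrite /contour_int.
have E1 := path_intD (path_continuousB (bottom_path cd cf) (top_path cd cf))
   (path_continuousB (bottom_path cd cg) (top_path cd cg)).
have E2 := path_intD (path_continuousB (right_path ab cf) (left_path ab cf))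
   (path_continuousB (right_path ab cg) (left_path ab cg)).
rewrite addrACA -mulrDr -E1 -E2; congr (_ + _ * _); apply: eq_path_int => t _;
  by rewrite opprD addrACA.
Qed.

Lemma contour_intZ k f a b c d : a <= b -> c <= d -> boundary_cont f a b c d ->
  contour_int (fun z => k * f z) a b c d = k * contour_int f a b c d.
Proof.
move=> ab cd cf; rewrite /contour_int mulrDr mulrCA.
rewrite -(path_intZ k (path_continuousB (bottom_path cd cf) (top_path cd cf))).
rewrite -(path_intZ k (path_continuousB (right_path ab cf) (left_path ab cf))).
by congr (_ + _ * _); apply: eq_path_int => t _; rewrite mulrBr.
Qed.

Lemma eq_contour_int f g a b c d : a <= b -> c <= d ->
  (forall x y, a <= x <= b -> c <= y <= d -> [\/ x = a, x = b, y = c | y = d] ->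
    f (x +i* y)%C = g (x +i* y)%C) ->
  contour_int f a b c d = contour_int g a b c d.
Proof.
move=> ab cd fg; congr (_ + _ * _); apply: eq_path_int => t tI; congr (_ - _); apply: fg;
  rewrite ?lexx ?andbT //; by [apply: Or41|apply: Or42|apply: Or43|apply: Or44].
Qed.

(** The common side of the two rectangles contributes twice, with opposite
    orientations. *)
Lemma contour_int_hcut f a b c d y : a <= b -> c <= y <= d ->
  boundary_cont f a b c y -> boundary_cont f a b y d ->
  contour_int f a b c d = contour_int f a b c y + contour_int f a b y d.
Proof.
move=> ab /andP[cy yd] c1 c2; rewrite /contour_int.
have P1 := path_continuousB (right_path ab c1) (left_path ab c1).
have P2 := path_continuousB (right_path ab c2) (left_path ab c2).
rewrite (@path_int_split _ _ c d y) ?cy //.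
  rewrite [RHS]addrACA -path_intD; last 2 first.
  - exact: path_continuousB (bottom_path cy c1) (top_path cy c1).
  - exact: path_continuousB (bottom_path yd c2) (top_path yd c2).
  rewrite -mulrDr; congr (_ + _ * _); apply: eq_path_int => t _.
  by rewrite addrA subrK.
move=> t /andP[ct td].
case: (lerP t y) => ty; last by apply: P2; rewrite td ltW.
by apply: P1; rewrite ct.
Qed.

Lemma contour_int_vcut f a b c d x : a <= x <= b -> c <= d ->
  boundary_cont f a x c d -> boundary_cont f x b c d ->
  contour_int f a b c d = contour_int f a x c d + contour_int f x b c d.
Proof.
move=> /andP[ax xb] cd c1 c2; rewrite /contour_int.
have P1 := path_continuousB (bottom_path cd c1) (top_path cd c1).
have P2 := path_continuousB (bottom_path cd c2) (top_path cd c2).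
rewrite (@path_int_split _ _ a b x) ?ax //.
  rewrite [RHS]addrACA -mulrDr -path_intD; last 2 first.
  - exact: path_continuousB (right_path ax c1) (left_path ax c1).
  - exact: path_continuousB (right_path xb c2) (left_path xb c2).
  congr (_ + _ * _); apply: eq_path_int => t _.
  by rewrite [RHS]addrC addrA subrK.
move=> t /andP[at_ tb].
case: (lerP t x) => tx; last by apply: P2; rewrite tb ltW.
by apply: P1; rewrite at_.
Qed.

End RectangleIntegral.

(** * Goursat's theorem *)

Section Goursat.
Variable R : realType.
Implicit Types (f g : R[i] -> R[i]) (a b c d x y t w h : R) (z l p : R[i]).

Lemma half_pow_small (C e : R) : 0 < e -> exists n, C * 2^-1 ^+ n < e.
Proof.
move=> e0; have [C0|C0] := lerP C 0.
  by exists 0%N; rewrite expr0 mulr1; lra.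
exists (Num.truncn (C / e)).+1.
set n := (Num.truncn _).+1; have : C / e < n%:R by rewrite truncnS_gt.
rewrite exprVn ltr_pdivrMr ?exprn_gt0 // => H.
have : (n%:R : R) <= 2 ^+ n by rewrite -natrX ler_nat ltnW // ltn_expl.
by move: H; rewrite ltr_pdivrMr //; nra.
Qed.

Lemma contour_int_affine k l a b c d : a <= b -> c <= d ->
  contour_int (fun z => k * z + l) a b c d = 0.
Proof.
move=> ab cd; rewrite /contour_int.
rewrite (@eq_path_int _ _ (fun=> k * ('i%C * ((c - d)%:C)%C))); last first.
  move=> t _; rewrite opprD addrACA subrr addr0 -mulrBr; congr (_ * _).
  by apply/eqP; rewrite eq_complex /=; apply/andP; split; apply/eqP; ring.
rewrite (@eq_path_int _ _ (fun=> k * (((b - a)%:C)%C)) c d); last first.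
  move=> t _; rewrite opprD addrACA subrr addr0 -mulrBr; congr (_ * _).
  by apply/eqP; rewrite eq_complex /=; apply/andP; split; apply/eqP; ring.
rewrite !path_int_cst // -(opprB d c) rmorphN /=; ring.
Qed.

Definition rect_cderivable f a b c d := forall x y, a <= x <= b -> c <= y <= d ->
  exists l, has_cderiv f (x +i* y)%C l.

Lemma rect_cderivableW f a b c d a' b' c' d' :
  a <= a' -> b' <= b -> c <= c' -> d' <= d ->
  rect_cderivable f a b c d -> rect_cderivable f a' b' c' d'.
Proof. by move=> ? ? ? ? H x y *; apply: H; lra. Qed.

Lemma rect_boundary f a b c d : rect_cderivable f a b c d -> boundary_cont f a b c d.
Proof. by move=> H x y xab ycd _; have [l] := H x y xab ycd; apply: cderiv_cont. Qed.

(** The integral is the sum of those over the four quarters, so one of these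
    carries at least a quarter of its modulus. *)
Lemma quarter_large f a c w h : 0 <= w -> 0 <= h ->
  rect_cderivable f a (a + w) c (c + h) ->
  exists a' c', [/\ a <= a', a' + w / 2 <= a + w, c <= c', c' + h / 2 <= c + h &
   cabs (contour_int f a (a + w) c (c + h)) <=
     4 * cabs (contour_int f a' (a' + w / 2) c' (c' + h / 2))].
Proof.
move=> w0 h0 df.
have E : contour_int f a (a + w) c (c + h) =
   contour_int f a (a + w / 2) c (c + h / 2) +
   contour_int f a (a + w / 2) (c + h / 2) (c + h / 2 + h / 2) +
   (contour_int f (a + w / 2) (a + w / 2 + w / 2) c (c + h / 2) +
    contour_int f (a + w / 2) (a + w / 2 + w / 2) (c + h / 2) (c + h / 2 + h / 2)).
  have -> : a + w / 2 + w / 2 = a + w by lra.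
  have -> : c + h / 2 + h / 2 = c + h by lra.
  have bc x1 x2 y1 y2 : a <= x1 -> x2 <= a + w -> c <= y1 -> y2 <= c + h ->
      boundary_cont f x1 x2 y1 y2.
    by move=> *; apply/rect_boundary/(rect_cderivableW _ _ _ _ df).
  have I1 : a <= a + w / 2 <= a + w by lra.
  have I2 : c <= c + h / 2 <= c + h by lra.
  have [I3 I4 I5] : [/\ a <= a + w / 2, a + w / 2 <= a + w & c <= c + h] by split; lra.
  rewrite (contour_int_vcut I1 I5); [|apply: bc; lra|apply: bc; lra].
  rewrite (contour_int_hcut I3 I2); [|apply: bc; lra|apply: bc; lra].
  by rewrite (contour_int_hcut I4 I2); [|apply: bc; lra|apply: bc; lra].
set I := cabs _.
apply: contrapT => N.
have small a' c' : a <= a' -> a' + w / 2 <= a + w -> c <= c' -> c' + h / 2 <= c + h ->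
    4 * cabs (contour_int f a' (a' + w / 2) c' (c' + h / 2)) < I.
  move=> *; rewrite ltNge; apply/negP => H; apply: N; exists a', c'; split=> //.
have pigeonhole (x1 x2 x3 x4 : R) : 4 * x1 < I -> 4 * x2 < I -> 4 * x3 < I ->
    4 * x4 < I -> I <= x1 + x2 + (x3 + x4) -> False by clear; lra.
apply: pigeonhole (small a c _ _ _ _) (small a (c + h / 2) _ _ _ _)
  (small (a + w / 2) c _ _ _ _) (small (a + w / 2) (c + h / 2) _ _ _ _) _;
  try (clear -w0 h0; lra).
rewrite /I E (le_trans (cabsD _ _)) // lerD ?cabsD //.
Qed.

Lemma nested_point (u w : nat -> R) : (forall n, 0 <= w n) ->
  (forall n, u n <= u n.+1 /\ u n.+1 + w n.+1 <= u n + w n) ->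
  exists x, forall n, u n <= x <= u n + w n.
Proof.
move=> w0 H.
have up m n : (m <= n)%N -> u m <= u n /\ u n + w n <= u m + w m.
  elim: n => [|n IH]; first by rewrite leqn0 => /eqP ->.
  rewrite leq_eqVlt => /predU1P[->//|]; rewrite ltnS => /IH[].
  by have [] := H n; lra.
have ub n : ubound (range u) (u n + w n).
  move=> _ [m _ <-]; have [/up[]|/ltnW /up[]] := leqP m n; have := w0 m; have := w0 n; lra.
have hs : has_sup (range u).
  by split; [exists (u 0%N); exists 0%N | exists (u 0%N + w 0%N); exact: ub].
exists (sup (range u)) => n; apply/andP; split.
  by apply: (sup_upper_bound hs); exists n.
by apply: sup_le_ub; [case: hs | exact: ub].
Qed.

(** Bisection gives nested rectangles Q_n, with sides scaled by 2^-n, whose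
    integrals are at least 4^-n times the original one in modulus.  Near their
    common point z the function differs from an affine one, whose integral is 0,
    by at most e |w - z|; error and perimeter are both O(2^-n), so the original
    integral is O(e). *)
Lemma goursat f a b c d : a <= b -> c <= d ->
  rect_cderivable f a b c d -> contour_int f a b c d = 0.
Proof.
move=> ab cd df.
pose w := b - a; pose h := d - c.
pose wn n := w * 2^-1 ^+ n; pose hn n := h * 2^-1 ^+ n.
have w0 : 0 <= w by rewrite /w; lra.
have h0 : 0 <= h by rewrite /h; lra.
have half n : 0 < (2^-1 : R) ^+ n by rewrite exprn_gt0.
have wn0 n : 0 <= wn n by rewrite mulr_ge0 // ltW.
have hn0 n : 0 <= hn n by rewrite mulr_ge0 // ltW.
have wnS n : wn n.+1 = wn n / 2 by rewrite /wn exprSr mulrA.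
have hnS n : hn n.+1 = hn n / 2 by rewrite /hn exprSr mulrA.
pose P n (q : R * R) := [/\ a <= q.1, q.1 + wn n <= b, c <= q.2, q.2 + hn n <= d &
  cabs (contour_int f a b c d) <=
    4 ^+ n * cabs (contour_int f q.1 (q.1 + wn n) q.2 (q.2 + hn n))].
have step (nq : nat * (R * R)) : exists q', P nq.1 nq.2 -> [/\ P nq.1.+1 q',
   nq.2.1 <= q'.1 /\ q'.1 + wn nq.1.+1 <= nq.2.1 + wn nq.1 &
   nq.2.2 <= q'.2 /\ q'.2 + hn nq.1.+1 <= nq.2.2 + hn nq.1].
  case: nq => n q /=; case: (pselect (P n q)) => [|N]; last by exists q => /N.
  case=> p1 p2 p3 p4 p5.
  have [a' [c' [q1 q2 q3 q4 q5]]] := quarter_large (wn0 n) (hn0 n)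
    (rect_cderivableW p1 p2 p3 p4 df).
  exists (a', c') => _; rewrite /P /= wnS hnS; split; try by split.
  split=> /=; [exact: le_trans p1 q1|exact: le_trans q2 p2
              |exact: le_trans p3 q3|exact: le_trans q4 p4|].
  apply: le_trans p5 _; by rewrite exprSr -mulrA ler_wpM2l // exprn_ge0.
have [F FP] := choice step.
pose s := fix s n := if n is m.+1 then F (m, s m) else (a, c).
have sP n : P n (s n).
  elim: n => [|n IH] /=; last by have [] := FP (n, s n) IH.
  by rewrite /P /= /wn /hn !expr0 !mulr1 mul1r /w /h !subrKC; split.
have [x xP] := @nested_point (fun n => (s n).1) wn wn0
  (fun n => let: And3 _ H _ := FP (n, s n) (sP n) in H).
have [y yP] := @nested_point (fun n => (s n).2) hn hn0
  (fun n => let: And3 _ _ H := FP (n, s n) (sP n) in H).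
have [sa sb sc sd _] := sP 0%N.
have [l fl] : exists l, has_cderiv f (x +i* y)%C l.
  by apply: df; move: (xP 0%N) (yP 0%N); lra.
set z := (x +i* y)%C in fl.
have key e : 0 < e -> cabs (contour_int f a b c d) <= 4 * (w + h) ^+ 2 * e.
  move=> e0; have [r r0 H] := fl e e0.
  have [n nr] := half_pow_small (w + h) r0.
  have [{}sa {}sb {}sc {}sd sI] := sP n; apply: le_trans sI _.
  set a' := (s n).1 in sa sb *; set c' := (s n).2 in sc sd *.
  have df' := rect_cderivableW sa sb sc sd df.
  have A : a' <= a' + wn n by have := wn0 n; lra.
  have B : c' <= c' + hn n by have := hn0 n; lra.
  have -> : contour_int f a' (a' + wn n) c' (c' + hn n) =
     contour_int (fun v => f v - f z - l * (v - z)) a' (a' + wn n) c' (c' + hn n).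
    rewrite -[LHS]addr0 -(@contour_int_affine (- l) (l * z - f z) _ _ _ _ A B).
    rewrite -contour_intD //; last 2 first.
    - exact: rect_boundary.
    - by move=> *; apply: cderiv_cont; exact: has_cderiv_affine.
    by apply: eq_contour_int => // v1 v2 _ _ _; ring.
  have cg : boundary_cont (fun v => f v - f z - l * (v - z)) a' (a' + wn n) c' (c' + hn n).
    move=> v1 v2 V1 V2 V3; have [m fm] := df' _ _ V1 V2.
    apply: (@cderiv_cont _ _ _ (m - l)) => e' e'0; have [r' r'0 H'] := fm e' e'0.
    exists r' => // v /H'; congr (cabs _ <= _); ring.
  have bd : cabs (contour_int (fun v => f v - f z - l * (v - z)) a' (a' + wn n) c' (c' + hn n))
     <= 4 * (e * (wn n + hn n)) * ((a' + wn n - a') + (c' + hn n - c')).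
    apply: contour_int_bound => // v1 v2 V1 V2 _.
    have vz : cabs ((v1 +i* v2)%C - z) <= wn n + hn n.
      apply: le_trans (cabs_le_ReIm _) _ => /=; apply: lerD; rewrite ler_norml.
        by move: (xP n); rewrite -/a'; lra.
      by move: (yP n); rewrite -/c'; lra.
    apply: le_trans (H _ (le_lt_trans vz _)) (ler_wpM2l (ltW e0) vz).
    by rewrite /wn /hn -mulrDl.
  apply: le_trans (ler_wpM2l (exprn_ge0 n _) bd) _; first lra.
  rewrite (_ : _ + _ = wn n + hn n); last by ring.
  rewrite /wn /hn -mulrDl.
  rewrite (_ : 4 ^+ n * _ = (4 * (2^-1 * 2^-1)) ^+ n * (4 * (w + h) ^+ 2 * e)).
    by rewrite (_ : 4 * _ = 1) ?expr1n ?mul1r //; field.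
  by rewrite !exprMn; ring.
apply: cabs_eq0_small => e e0.
have K0 : 0 <= 4 * (w + h) ^+ 2 by rewrite mulr_ge0 // exprn_ge0 // addr_ge0.
apply: le_trans (key (e / (4 * (w + h) ^+ 2 + 1)) _) _.
  by rewrite divr_gt0 //; lra.
by rewrite mulrA ler_pdivrMr; nra.
Qed.

End Goursat.

(** * Cauchy's formula and Taylor's theorem *)

Section CauchyTaylor.
Variable R : realType.
Implicit Types (f g : R[i] -> R[i]) (a b c d x y t r : R) (z w l p : R[i]).

Local Notation sq f r := (contour_int f (- r) r (- r) r).

(** The four rectangles cut off do not contain the singular point, so Goursat's
    theorem applies to them. *)
Lemma contour_int_shrink g x0 y0 a b c d e :
  (forall z, z != (x0 +i* y0)%C -> exists l, has_cderiv g z l) -> 0 < e ->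
  a <= x0 - e -> x0 + e <= b -> c <= y0 - e -> y0 + e <= d ->
  contour_int g a b c d = contour_int g (x0 - e) (x0 + e) (y0 - e) (y0 + e).
Proof.
move=> dg e0 ax xb cy yd.
have dgxy x y : (x != x0) || (y != y0) -> exists l, has_cderiv g (x +i* y)%C l.
  by move=> xy; apply: dg; rewrite eq_complex /= negb_and.
have bc x1 x2 y1 y2 : x1 != x0 -> x2 != x0 -> y1 != y0 -> y2 != y0 ->
    boundary_cont g x1 x2 y1 y2.
  move=> X1 X2 Y1 Y2 x y _ _ H.
  have [|l] := dgxy x y; last exact: cderiv_cont.
  by case: H => ->; rewrite ?X1 ?X2 ?Y1 ?Y2 ?orbT.
have [l1 l2 l3 l4] : [/\ a < x0, x0 < b, c < y0 & y0 < d] by split; lra.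
have [l5 l6 l7 l8] : [/\ x0 - e < x0, x0 < x0 + e, y0 - e < y0 & y0 < y0 + e].
  by split; lra.
have Z x1 x2 y1 y2 : x1 <= x2 -> y1 <= y2 ->
    (forall x y, x1 <= x <= x2 -> y1 <= y <= y2 -> (x != x0) || (y != y0)) ->
    contour_int g x1 x2 y1 y2 = 0.
  by move=> X Y H; apply: goursat => // x y xI yI; apply: dgxy; apply: H.
rewrite (@contour_int_vcut _ g a b c d (x0 - e)); first last.
- by apply: bc; rewrite ?(lt_eqF l5) ?(gt_eqF l2) ?(lt_eqF l3) ?(gt_eqF l4).
- by apply: bc; rewrite ?(lt_eqF l5) ?(lt_eqF l1) ?(lt_eqF l3) ?(gt_eqF l4).
- by lra.
- by lra.
rewrite Z ?add0r; [|lra|lra|by move=> x y xI yI; rewrite lt_eqF //; lra].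
rewrite (@contour_int_vcut _ g (x0 - e) b c d (x0 + e)); first last.
- by apply: bc; rewrite ?(gt_eqF l6) ?(gt_eqF l2) ?(lt_eqF l3) ?(gt_eqF l4).
- by apply: bc; rewrite ?(lt_eqF l5) ?(gt_eqF l6) ?(lt_eqF l3) ?(gt_eqF l4).
- by lra.
- by lra.
rewrite [X in _ + X]Z ?addr0; [|lra|lra|by move=> x y xI yI; rewrite gt_eqF //; lra].
rewrite (@contour_int_hcut _ g (x0 - e) (x0 + e) c d (y0 - e)); first last.
- by apply: bc; rewrite ?(gt_eqF l6) ?(lt_eqF l5) ?(lt_eqF l7) ?(gt_eqF l4).
- by apply: bc; rewrite ?(gt_eqF l6) ?(lt_eqF l5) ?(lt_eqF l7) ?(lt_eqF l3).
- by lra.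
- by lra.
rewrite Z ?add0r; [|lra|lra|by move=> x y xI yI; rewrite [y == _]lt_eqF ?orbT //; lra].
rewrite (@contour_int_hcut _ g (x0 - e) (x0 + e) (y0 - e) d (y0 + e)); first last.
- by apply: bc; rewrite ?(gt_eqF l6) ?(lt_eqF l5) ?(gt_eqF l8) ?(gt_eqF l4).
- by apply: bc; rewrite ?(gt_eqF l6) ?(lt_eqF l5) ?(lt_eqF l7) ?(gt_eqF l8).
- by lra.
- by lra.
by rewrite [X in _ + X]Z ?addr0 // => [|x y xI yI]; [lra|rewrite [y == _]gt_eqF ?orbT //; lra].
Qed.

Lemma square_edge_ge r x y : 0 < r ->
  [\/ x = - r, x = r, y = - r | y = r] -> r <= cabs (x +i* y)%C.
Proof.
move=> r0 H; have := Re_le_cabs (x +i* y)%C; have := Im_le_cabs (x +i* y)%C => /=.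
by case: H => ->; rewrite ?normrN ?(gtr0_norm r0).
Qed.

Lemma square_boundary_cont g r : 0 < r ->
  (forall z, r <= cabs z -> exists l, has_cderiv g z l) ->
  boundary_cont g (- r) r (- r) r.
Proof.
move=> r0 dg x y _ _ /(square_edge_ge r0)/dg[l]; exact: cderiv_cont.
Qed.

Lemma square_bound g r (M : R) : 0 < r ->
  (forall z, r <= cabs z -> exists l, has_cderiv g z l) ->
  (forall x y, `|x| <= r -> `|y| <= r -> r <= cabs (x +i* y)%C ->
    cabs (g (x +i* y)%C) <= M) ->
  cabs (sq g r) <= 16 * M * r.
Proof.
move=> r0 dg gM.
have -> : 16 * M * r = 4 * M * ((r - - r) + (r - - r)) by ring.
apply: contour_int_bound; try lra; first exact: square_boundary_cont.
move=> x y xr yr H; apply: gM; rewrite ?ler_norml //.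
exact: square_edge_ge H.
Qed.

(** After shrinking the contour to a square of side 2q around p, the bounded
    integrand contributes only O(q). *)
Lemma removable_square g p r : 0 < r -> cabs p < r ->
  (forall z, z != p -> exists l, has_cderiv g z l) ->
  (exists (M e : R), 0 < e /\ forall z, z != p -> cabs (z - p) < e -> cabs (g z) <= M) ->
  sq g r = 0.
Proof.
case: p => x0 y0 r0 pr dg [M [e [e0 gM]]].
have := Re_le_cabs (x0 +i* y0)%C; have := Im_le_cabs (x0 +i* y0)%C => /=.
rewrite !ler_norml => yp xp.
set s := cabs _ in pr xp yp.
apply: cabs_eq0_small => k k0.
have M0 : 0 <= `|M| by [].
(* Small enough for the square to lie in the given one and in the region where
   g is bounded, and for 4 * `|M| * 4 q to be at most k. *)
pose q := Num.min (r - s) (Num.min (e / 4) (k / (32 * (`|M| + 1)))).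
have q0 : 0 < q.
  by rewrite !lt_min; apply/and3P; split; [lra|lra|apply: divr_gt0; lra].
have q1 : q <= r - s by rewrite /q ge_min lexx.
have q2 : q <= e / 4 by rewrite /q !ge_min lexx orbT.
have q3 : q <= k / (32 * (`|M| + 1)) by rewrite /q !ge_min lexx !orbT.
rewrite (@contour_int_shrink g x0 y0 _ _ _ _ q) //; try lra.
have off x y : [\/ x = x0 - q, x = x0 + q, y = y0 - q | y = y0 + q] ->
    (x +i* y)%C != (x0 +i* y0)%C.
  rewrite eq_complex /= negb_and; case=> ->; rewrite -subr_eq0;
   [rewrite addrAC subrr add0r oppr_eq0 gt_eqF // | rewrite addrAC subrr add0r gt_eqF //
   | rewrite orbC -subr_eq0 addrAC subrr add0r oppr_eq0 gt_eqF //
   | rewrite orbC -subr_eq0 addrAC subrr add0r gt_eqF //].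
apply: le_trans (@contour_int_bound _ g _ _ _ _ `|M| _ _ _ _) _; try lra.
- move=> x y _ _ /off/dg[l]; exact: cderiv_cont.
- move=> x y xI yI H; apply: le_trans (ler_norm M); apply: gM; first exact: off H.
  apply: le_lt_trans (cabs_le_ReIm _) _ => /=.
  have : `|x - x0| <= q by rewrite ler_norml; lra.
  have : `|y - y0| <= q by rewrite ler_norml; lra.
  lra.
move: q3; rewrite ler_pdivlMr; last lra.
by move=> q3; nra.
Qed.

Lemma bounded_on_square f r : (forall z, ccont f z) ->
  exists M, forall x y, `|x| <= r -> `|y| <= r -> cabs (f (x +i* y)%C) <= M.
Proof.
move=> cf; pose F (q : R * R) : R := cabs (f (q.1 +i* q.2)%C).
have cF : continuous F.
  move=> -[x y]; apply/cvgrPdist_le => /= e e0; have [d d0 H] := cf (x +i* y)%C e e0.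
  have d2 : 0 < d / 2 by rewrite divr_gt0.
  exists (ball x (d / 2), ball y (d / 2)); first by split; exact: nbhsx_ballx.
  move=> -[x' y'] [] /=; rewrite /ball /= => bx by_; rewrite distrC.
  have {}H : cabs (f (x' +i* y')%C - f (x +i* y)%C) <= e.
    apply: H; apply: le_lt_trans (cabs_le_ReIm _) _ => /=.
    by rewrite distrC [`|y' - y|]distrC; lra.
  apply: le_trans H; rewrite /F /= ler_norml cabs_triangle andbT.
  by have := cabs_triangle (f (x +i* y)%C) (f (x' +i* y')%C); rewrite cabs_distC; lra.
have cK : compact (`[- r, r] `*` `[- r, r] : set (R * R)).
  by apply: compact_setX; apply: segment_compact.
have /compact_bounded[M [_ /(_ (M + 1))]] := continuous_compact (continuous_subspaceT cF) cK.
rewrite ltrDl ltr01 => /(_ isT) H; exists (M + 1) => x y xr yr.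
have := H (F (x, y)); rewrite /F /= ger0_norm ?cabs_ge0 //; apply.
by exists (x, y) => //; split; rewrite /= in_itv /= -ler_norml.
Qed.

Lemma cderivable_invX z n : z != 0 -> exists l, has_cderiv (fun w => w^-1 ^+ n) z l.
Proof.
move=> z0; elim: n => [|n IH]; first exact: (cderivable_cst 1).
have [|l H] := @cderivable_mul R (fun w => w^-1) (fun w => w^-1 ^+ n) z _ IH.
  apply: cderivable_inv => //; exists 1 => e e0; have [r r0 H] := has_cderiv_affine 1 0 z e0.
  by exists r => // w /H; rewrite !mul1r !addr0.
by exists l => e e0; have [r r0 {}H] := H e e0; exists r => // w /H; rewrite -!exprS.
Qed.

Lemma moment_cderiv f w n : (exists l, has_cderiv f w l) -> w != 0 ->
  exists l, has_cderiv (fun w => f w * w^-1 ^+ n) w l.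
Proof. by move=> df w0; apply: cderivable_mul => //; exact: cderivable_invX. Qed.

Lemma kernel_cderiv f z w : (exists l, has_cderiv f w l) -> w != z ->
  exists l, has_cderiv (fun w => f w * (w - z)^-1) w l.
Proof.
move=> df wz; apply: cderivable_mul => //; apply: cderivable_inv.
  by rewrite subr_eq0.
exists 1 => e e0; have [r r0 H] := has_cderiv_affine 1 (- z) w e0.
by exists r => // v /H; rewrite !mul1r.
Qed.

(** The difference quotient of f at z is bounded near z, so its integral
    vanishes by [removable_square]. *)
Lemma cauchy_formula f z r : 0 < r -> cabs z < r ->
  (forall w, exists l, has_cderiv f w l) ->
  sq (fun w => f w * (w - z)^-1) r = f z * sq (fun w => 1 * (w - z)^-1) r.
Proof.
move=> r0 zr df.
have far w : r <= cabs w -> w != z.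
  by move=> rw; apply: contraTneq zr => <-; rewrite -leNgt.
have rr : - r <= r by lra.
have bcf : boundary_cont (fun w => f w * (w - z)^-1) (- r) r (- r) r.
  by apply: square_boundary_cont => // w /far; apply: kernel_cderiv.
have bc1 : boundary_cont (fun w => 1 * (w - z)^-1) (- r) r (- r) r.
  apply: square_boundary_cont => // w /far; apply: (kernel_cderiv (f := fun=> 1)).
  exact: cderivable_cst.
apply/eqP; rewrite -subr_eq0 -mulNr -contour_intZ // -contour_intD //; last first.
  apply: square_boundary_cont => // w /far wz.
  apply: (cderivable_mul (f := fun=> - f z)); first exact: cderivable_cst.
  by apply: (kernel_cderiv (f := fun=> 1)) => //; exact: cderivable_cst.
apply/eqP.
rewrite (@eq_contour_int _ _ (fun w => (f w - f z) * (w - z)^-1)) //; last first.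
  by move=> x y _ _ _; ring.
apply: (@removable_square _ z) => //.
  move=> w wz; apply: (kernel_cderiv (f := fun w => f w - f z)) => //.
  have [l H] := df w; exists l => e /H[d d0 {}H]; exists d => // v /H.
  by congr (cabs (_ - _) <= _); ring.
have [l H] := df z; have [e e0 {}H] := H 1 ltr01.
exists (cabs l + 1), e; split => // w wz /H {}H.
rewrite cabsM cabsV ler_pdivrMr ?cabs_gt0 ?subr_eq0 //.
have -> : f w - f z = (f w - f z - l * (w - z)) + l * (w - z) by ring.
by apply: le_trans (cabsD _ _) _; rewrite cabsM; lra.
Qed.

(** Up to the constant factor [moment (fun=> 1) r 0] (which is 2 pi i), these are
    the Taylor coefficients of f at 0. *)
Definition moment f r k := sq (fun w => f w * w^-1 ^+ k.+1) r.

Lemma square_off_center r w : 0 < r -> r <= cabs w -> w != 0.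
Proof. by move=> r0 rw; rewrite -cabs_gt0; lra. Qed.

Lemma square_off z r w : cabs z < r -> r <= cabs w -> w != z.
Proof. by move=> zr rw; apply: contraTneq zr => <-; rewrite -leNgt. Qed.

(** The finite geometric expansion of 1 / (w - z) in powers of z / w. *)
Lemma kernel_expansion f z r n : 0 < r -> cabs z < r ->
  (forall w, exists l, has_cderiv f w l) ->
  sq (fun w => f w * (w - z)^-1) r = \sum_(k < n) moment f r k * z ^+ k +
    z ^+ n * sq (fun w => f w * w^-1 ^+ n * (w - z)^-1) r.
Proof.
move=> r0 zr df; elim: n => [|n IH].
  rewrite big_ord0 add0r expr0 mul1r; apply: eq_contour_int; try lra.
  by move=> x y _ _ _; rewrite expr0 mulr1.
rewrite big_ord_recr /= -addrA IH; congr (_ + _).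
rewrite [moment _ _ _ * _]mulrC exprSr -mulrA -mulrDr; congr (_ * _).
have rr : - r <= r by lra.
have bc m : boundary_cont (fun w => f w * w^-1 ^+ m * (w - z)^-1) (- r) r (- r) r.
  apply: square_boundary_cont => // w rw.
  apply: (kernel_cderiv (f := fun w => f w * w^-1 ^+ m)); last exact: square_off rw.
  by apply: moment_cderiv => //; exact: square_off_center rw.
rewrite -contour_intZ // -contour_intD //.
- apply: eq_contour_int => // x y _ _ H.
  have rw := square_edge_ge r0 H.
  have w0 := square_off_center r0 rw; have wz := square_off zr rw.
  set w := (_ +i* _)%C in w0 wz *; rewrite exprS.
  have wz' : w - z != 0 by rewrite subr_eq0.
  rewrite !exprVn; have wn : w ^+ n != 0 by rewrite expf_neq0.
  by field; rewrite wn wz' w0.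
- apply: square_boundary_cont => // w rw.
  by apply: moment_cderiv => //; exact: square_off_center rw.
- apply: square_boundary_cont => // w rw; apply: (cderivable_mul (f := fun=> z)).
    exact: cderivable_cst.
  apply: (kernel_cderiv (f := fun w => f w * w^-1 ^+ n.+1)); last exact: square_off rw.
  by apply: moment_cderiv => //; exact: square_off_center rw.
Qed.

Lemma edge_invX r w n : 0 < r -> r <= cabs w -> cabs (w^-1 ^+ n) <= r^-1 ^+ n.
Proof.
move=> r0 rw; rewrite cabsX cabsV lerXn2r ?nnegrE ?invr_ge0 ?cabs_ge0 ?(ltW r0) //.
by rewrite lef_pV2 ?posrE; lra.
Qed.

(** Cauchy's estimate. *)
Lemma moment_bound f r (M : R) k : 0 < r -> (forall w, exists l, has_cderiv f w l) ->
  (forall x y, `|x| <= r -> `|y| <= r -> cabs (f (x +i* y)%C) <= M) ->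
  cabs (moment f r k) * r ^+ k <= 16 * M.
Proof.
move=> r0 df fM; have M0 : 0 <= M.
  by apply: le_trans (cabs_ge0 _) (fM 0 0 _ _); rewrite normr0 ltW.
have : cabs (moment f r k) <= 16 * (M * r^-1 ^+ k.+1) * r.
  apply: square_bound => // [w rw|x y xr yr rw].
    by apply: moment_cderiv => //; exact: square_off_center rw.
  by rewrite cabsM ler_pM ?cabs_ge0 ?fM ?edge_invX.
rewrite -(ler_pM2r (x := r ^+ k)) ?exprn_gt0 // => H.
apply: le_trans H _; rewrite le_eqVlt; apply/orP; left; apply/eqP.
rewrite exprVn exprS; field; rewrite ?expf_neq0 ?gt_eqF //.
Qed.

(** The remainder in [kernel_expansion] is O((|z| / r)^n), as |w| >= r on the
    boundary of the square. *)
Lemma kernel_has_sum f z r : 0 < r -> cabs z < r ->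
  (forall w, exists l, has_cderiv f w l) ->
  has_sum (fun k => moment f r k * z ^+ k) (sq (fun w => f w * (w - z)^-1) r).
Proof.
move=> r0 zr df e e0; have z0 := cabs_ge0 z.
have [M fM] := bounded_on_square r (fun w => let: ex_intro _ H := df w in cderiv_cont H).
have M0 : 0 <= M.
  by apply: le_trans (cabs_ge0 _) (fM 0 0 _ _); rewrite normr0 ltW.
pose q := cabs z / r.
have q0 : 0 <= q by rewrite divr_ge0 // ltW.
have q1 : q < 1 by rewrite ltr_pdivrMr // mul1r.
have rz : 0 < r - cabs z by lra.
have B n : cabs (z ^+ n * sq (fun w => f w * w^-1 ^+ n * (w - z)^-1) r) <=
    16 * (M / (r - cabs z)) * r * q ^+ n.
  rewrite cabsM cabsX /q exprMn mulrC [cabs z ^+ n * _]mulrC [X in _ <= X]mulrA.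
  rewrite ler_wpM2r ?exprn_ge0 //.
  have -> : 16 * (M / (r - cabs z)) * r * r^-1 ^+ n =
    16 * (M * r^-1 ^+ n * (r - cabs z)^-1) * r by ring.
  apply: square_bound => // [w rw|x y xr yr rw].
    apply: (kernel_cderiv (f := fun w => f w * w^-1 ^+ n)); last exact: square_off rw.
    by apply: moment_cderiv => //; exact: square_off_center rw.
  rewrite !cabsM !ler_pM ?mulr_ge0 ?cabs_ge0 ?fM ?edge_invX //.
  have := cabs_triangle (x +i* y)%C z => H.
  rewrite cabsV lef_pV2 ?posrE; lra.
have : geometric (16 * (M / (r - cabs z)) * r) q @ \oo --> (0 : R).
  by apply: cvg_geometric; rewrite ger0_norm.
move=> /cvgrPdist_le /(_ _ e0)[N _ HN]; exists N => n /HN /=.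
rewrite sub0r normrN => H.
rewrite (kernel_expansion n r0 zr df) opprD addrA subrr sub0r cabsN.
by apply: le_trans (B n) (le_trans (ler_norm _) H).
Qed.

Lemma moment_radius f r s k : 0 < r -> r <= s -> (forall w, exists l, has_cderiv f w l) ->
  moment f s k = moment f r k.
Proof.
move=> r0 rs df; rewrite /moment (@contour_int_shrink _ 0 0 _ _ _ _ r) ?sub0r ?add0r //; try lra.
by move=> z z0; apply: moment_cderiv.
Qed.

(** By Cauchy's estimate the integral of w^-(k+2) is O(s^-(k+1)) on the square of
    half side s, while it is independent of s. *)
Lemma moment1_0 k : moment (fun=> 1) 1 k.+1 = 0.
Proof.
have dc w : exists l, has_cderiv (fun=> 1) w l by exact: cderivable_cst.
apply: cabs_eq0_small => e e0.
(* Large enough for Cauchy's estimate 16 / s to be at most e. *)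
pose s : R := 1 + 16 / e.
have s1 : 1 <= s by rewrite lerDl divr_ge0 ?ltW.
rewrite -(@moment_radius _ 1 s) //.
have := @moment_bound (fun=> 1) s 1 k.+1 ltac:(lra) dc
  ltac:(by move=> *; rewrite cabs1).
have se : 16 <= s * e by rewrite mulrDl divfK ?gt_eqF //; lra.
have : s <= s ^+ k.+1 by rewrite exprS ler_peMr ?exprn_ege1 //; lra.
have := cabs_ge0 (moment (fun=> 1) s k.+1); set I := cabs _; set S := _ ^+ _; nra.
Qed.

(** This bounds |2 pi i| from below without evaluating the integral.  Each pair of
    opposite sides contributes i times the integral of 2r / (t^2 + r^2) over
    [-r, r], where the integrand is at least 1 / r. *)
Lemma winding_number_lower r : 0 < r -> 4 <= cabs (moment (fun=> 1) r 0).
Proof.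
move=> r0; apply: le_trans (Im_le_cabs _); apply: le_trans (ler_norm _).
have rr : - r <= r by lra.
have bc : boundary_cont (fun w => 1 * w^-1 ^+ 1) (- r) r (- r) r.
  apply: square_boundary_cont => // w rw.
  by apply: (moment_cderiv (f := fun=> 1)); [exact: cderivable_cst|exact: square_off_center rw].
have := path_continuousB (right_path rr bc) (left_path rr bc).
rewrite /moment /contour_int.
pose phi t := 2 * r / (t ^+ 2 + r ^+ 2).
have nz t : t ^+ 2 + r ^+ 2 != 0 by rewrite gt_eqF // ltr_wpDl ?sqr_ge0 ?exprn_gt0.
have E1 t : 1 * (t +i* - r)%C^-1 ^+ 1 - 1 * (t +i* r)%C^-1 ^+ 1 = (0 +i* phi t)%C.
  rewrite !mul1r !expr1; apply/eqP; rewrite eq_complex /phi /= !sqrrN.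
  by apply/andP; split; apply/eqP; field; exact: nz.
have E2 t : 1 * (r +i* t)%C^-1 ^+ 1 - 1 * (- r +i* t)%C^-1 ^+ 1 = ((phi t)%:C)%C.
  rewrite !mul1r !expr1; apply/eqP; rewrite eq_complex /phi /= !sqrrN.
  rewrite [r ^+ 2 + _]addrC subrr eqxx andbT; apply/eqP; field; exact: nz.
rewrite (funext E1) (funext E2) => /integrable_Re /= iphi.
rewrite mul0r add0r mul1r.
suff : 2 <= \int[@lebesgue_measure R]_(t in `[- r, r]) phi t by lra.
have -> : 2 = \int[@lebesgue_measure R]_(t in `[- r, r]) r^-1.
  by rewrite Rintegral_cst // measure_segment //; field; rewrite gt_eqF.
apply: le_Rintegral => //.
  by apply: real_cont_integrable => t _ e e0; exists 1 => // s _; rewrite subrr normr0 ltW.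
move=> t; rewrite /= in_itv /= => tr.
rewrite /phi ler_pdivlMr ?lt_neqAle ?[0 == _]eq_sym ?nz ?addr_ge0 ?sqr_ge0 //.
rewrite mulrC ler_pdivrMr //; nra.
Qed.

(** For |z| < r, [cauchy_formula] and [kernel_has_sum] expand f(z) into a power
    series, with coefficients independent of r.  Cauchy's estimate on all squares
    gives rapid decrease; on the unit square it shows that coefficients depend
    continuously on f. *)
Lemma entire_taylor f : (forall w, exists l, has_cderiv f w l) ->
  exists a : nat -> R[i], [/\ rapid a, pseries_sum a f &
    forall M, (forall x y, `|x| <= 1 -> `|y| <= 1 -> cabs (f (x +i* y)%C) <= M) ->
      forall k, cabs (a k) <= 4 * M].
Proof.
move=> df; have dc w : exists l, has_cderiv (fun=> 1) w l by exact: cderivable_cst.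
pose c := moment (fun=> 1) 1 0; have c4 : 4 <= cabs c by exact: winding_number_lower.
have c0 : c != 0 by rewrite -cabs_gt0; lra.
pose a k := moment f 1 k / c.
have bound r M k : 1 <= r ->
    (forall x y, `|x| <= r -> `|y| <= r -> cabs (f (x +i* y)%C) <= M) ->
    cabs (a k) * r ^+ k <= 4 * M.
  move=> r1 fM; have r0 : 0 < r by lra.
  have M0 : 0 <= M by apply: le_trans (cabs_ge0 _) (fM 0 0 _ _); rewrite normr0 ltW.
  rewrite /a cabsM cabsV mulrAC ler_pdivrMr; last lra.
  rewrite -(moment_radius k ltr01 r1 df); apply: le_trans (moment_bound k r0 df fM) _.
  by nra.
exists a; split.
- move=> r r0.
  have [M fM] := bounded_on_square (r + 1) (fun w => let: ex_intro _ H := df w in cderiv_cont H).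
  exists (4 * M) => k; apply: le_trans (bound (r + 1) M k _ fM); last lra.
  by rewrite ler_wpM2l ?cabs_ge0 // lerXn2r ?nnegrE; lra.
- move=> z; have z0 := cabs_ge0 z.
  pose r := cabs z + 1; have r0 : 0 < r by rewrite /r; lra.
  have zr : cabs z < r by rewrite /r; lra.
  have r1 : 1 <= r by rewrite /r; lra.
  (* Cauchy's kernel has a constant integral, since the moments of 1 of positive
     index vanish. *)
  have J : sq (fun w => 1 * (w - z)^-1) r = c.
    apply: has_sum_unique (kernel_has_sum r0 zr dc) _.
    rewrite -[c]addr0; have -> : c = moment (fun=> 1) r 0 * z ^+ 0.
      by rewrite expr0 mulr1 (moment_radius 0 ltr01 r1 dc).
    apply: has_sum_shift; have := @has_sum_finite R (fun=> 0) 0 (fun _ _ => erefl).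
    rewrite big_ord0; apply: has_sum_eq => k.
    by rewrite (moment_radius _ ltr01 r1 dc) moment1_0 mul0r.
  have := kernel_has_sum r0 zr df; rewrite (cauchy_formula r0 zr df) J.
  move=> /(has_sum_scale c^-1); rewrite mulrCA mulVf // mulr1.
  by apply: has_sum_eq => k; rewrite (moment_radius _ ltr01 r1 df) /a mulrA [_^-1 * _]mulrC.
- by move=> M fM k; have := bound 1 M k (lexx _) fM; rewrite expr1n mulr1.
Qed.

End CauchyTaylor.

(** * Weighted norms of coefficient sequences *)

Section WeightedNorm.
Variable R : realType.
Implicit Types (a b : nat -> R[i]) (r C : R) (k n N : nat).

(** On sequences of Taylor coefficients, these norms define the topology of
    uniform convergence on discs; unlike suprema over discs they can be compared
    coefficient by coefficient. *)
Definition coef_norm r a : R := sup (range (fun k => cabs (a k) * r ^+ k)).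

Lemma coef_norm_ge r a k : 0 <= r -> rapid a -> cabs (a k) * r ^+ k <= coef_norm r a.
Proof.
move=> r0 /(_ r r0)[C aC]; apply: sup_ubound; last by exists k.
by exists C => _ [m _ <-].
Qed.

Lemma coef_norm_le r a C : (forall k, cabs (a k) * r ^+ k <= C) -> coef_norm r a <= C.
Proof.
move=> aC; apply: sup_le_ub; first by exists (cabs (a 0%N) * r ^+ 0); exists 0%N.
by move=> _ [m _ <-].
Qed.

Lemma coef_norm_ge0 r a : 0 <= r -> rapid a -> 0 <= coef_norm r a.
Proof.
by move=> r0 ra; apply: le_trans (coef_norm_ge 0 r0 ra); rewrite expr0 mulr1 cabs_ge0.
Qed.

Lemma rapid_add a b : rapid a -> rapid b -> rapid (fun k => a k + b k).
Proof.
move=> ra rb r r0; have [C aC] := ra r r0; have [D bD] := rb r r0.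
exists (C + D) => k; apply: le_trans (lerD (aC k) (bD k)).
by rewrite -mulrDl ler_wpM2r ?exprn_ge0 ?cabsD.
Qed.

Lemma rapid_scale (l : R[i]) a : rapid a -> rapid (fun k => l * a k).
Proof.
move=> ra r r0; have [C aC] := ra r r0; exists (cabs l * C) => k.
by rewrite cabsM -mulrA ler_wpM2l ?cabs_ge0.
Qed.

Lemma rapid0 : rapid (fun=> 0 : R[i]).
Proof. by move=> r r0; exists 0 => k; rewrite cabs0 mul0r. Qed.

Lemma rapid_sum n (u : nat -> nat -> R[i]) : (forall j, rapid (u j)) ->
  rapid (fun k => \sum_(j < n) u j k).
Proof.
move=> ru; elim: n => [|n IH].
  by have := rapid0; congr rapid; apply/funext => k; rewrite big_ord0.
have := rapid_add IH (ru n); congr rapid; apply/funext => k.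
by rewrite big_ord_recr.
Qed.

Lemma rapid_dilate (l : R[i]) a : rapid a -> rapid (fun k => l ^+ k * a k).
Proof.
move=> ra r r0; have [C aC] := ra (cabs l * r) ltac:(by rewrite mulr_ge0 ?cabs_ge0).
exists C => k; apply: le_trans (aC k).
by rewrite cabsM cabsX exprMn [cabs l ^+ k * _]mulrC -mulrA.
Qed.

Lemma rapid_iter_deriv_seq n a : rapid a -> rapid (iter n (@deriv_seq R) a).
Proof. by move=> ra; elim: n => //= n; apply: rapid_deriv_seq. Qed.

Definition vanish N a := forall k, (k < N)%N -> a k = 0.

Lemma vanishW m N a : (m <= N)%N -> vanish N a -> vanish m a.
Proof. by move=> mN va k km; apply: va; apply: leq_trans mN. Qed.

Lemma vanish_iter_deriv_seq j N a : vanish (N + j) a -> vanish N (iter j (@deriv_seq R) a).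
Proof.
elim: j N => [|j IH] N /=; first by rewrite addn0.
by rewrite addnS -addSn => /IH va k kN; rewrite /deriv_seq va ?mulr0.
Qed.

(** Differentiation multiplies the k-th term by k / r, and only k >= m occur. *)
Lemma coef_norm_deriv_seq_ge r (m : nat) a : 0 < r -> (0 < m)%N -> rapid a -> vanish m a ->
  coef_norm r a <= r / m%:R * coef_norm r (deriv_seq a).
Proof.
move=> r0 m0 ra va; have m0' : 0 < m%:R :> R by rewrite ltr0n.
have W0 := coef_norm_ge0 (ltW r0) (rapid_deriv_seq ra).
apply: coef_norm_le => k; have [km|mk] := ltnP k m.
  by rewrite va // cabs0 mul0r mulr_ge0 // divr_ge0 // ltW.
case: k mk => [|k] mk; first by move: (leq_trans m0 mk).
have := coef_norm_ge k (ltW r0) (rapid_deriv_seq ra).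
rewrite /deriv_seq cabsM cabs_nat => H.
rewrite mulrAC ler_pdivlMr // exprS.
have mk' : m%:R <= k.+1%:R :> R by rewrite ler_nat.
have A0 : 0 <= cabs (a k.+1) * r ^+ k by rewrite mulr_ge0 ?cabs_ge0 ?exprn_ge0 ?(ltW r0).
have := ler_wpM2l A0 mk'; move: H; rewrite -mulrA mulrC.
set A := _ * r ^+ k in A0 *; set W := coef_norm _ _ => H H'.
rewrite (_ : _ * _ * _ = r * (A * m%:R)); last by rewrite /A; ring.
by apply: (ler_wpM2l (ltW r0)); apply: le_trans H' H.
Qed.

(** Every term that occurs has index at least N. *)
Lemma coef_norm_half N r a : 0 < r -> rapid a -> vanish N a ->
  2 ^+ N * coef_norm (r / 2) a <= coef_norm r a.
Proof.
move=> r0 ra va; rewrite -ler_pdivlMl ?exprn_gt0 //.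
apply: coef_norm_le => k; have W0 := coef_norm_ge0 (ltW r0) ra.
have [kN|Nk] := ltnP k N.
  by rewrite va // cabs0 mul0r mulr_ge0 // invr_ge0 exprn_ge0.
rewrite exprMn mulrA mulrC exprVn; apply: ler_pM => //.
- by rewrite mulr_ge0 ?cabs_ge0 ?exprn_ge0 ?(ltW r0).
- by rewrite lef_pV2 ?posrE ?exprn_gt0 // ler_eXn2l // ltr1n.
- exact: coef_norm_ge (ltW r0) ra.
Qed.

End WeightedNorm.

(** * The operator on coefficient sequences *)

Section OperatorOnCoefficients.
Variables (R : realType) (lambda : R[i]) (p : {poly R[i]}).
Hypothesis hp : (1 < size p)%N.
Implicit Types (a b : nat -> R[i]) (r s C : R) (k n N : nat).

(** The effect of p(D) on Taylor coefficients. *)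
Definition coef_diff_poly a k := \sum_(j < size p) p`_j * iter j (@deriv_seq R) a k.

(** The effect of L on Taylor coefficients: dilation by lambda multiplies the k-th
    one by lambda^k. *)
Definition coef_op a k := lambda ^+ k * coef_diff_poly a k.

Lemma rapid_diff_poly a : rapid a -> rapid (coef_diff_poly a).
Proof.
move=> ra; apply: (@rapid_sum _ _ (fun j k => p`_j * iter j (@deriv_seq R) a k)) => j.
exact/rapid_scale/rapid_iter_deriv_seq.
Qed.

Lemma rapid_op a : rapid a -> rapid (coef_op a).
Proof. by move=> ra; apply/rapid_dilate/rapid_diff_poly. Qed.

Lemma rapid_iter_op n a : rapid a -> rapid (iter n coef_op a).
Proof. by move=> ra; elim: n => //= n; apply: rapid_op. Qed.

Lemma vanish_op N a : vanish (N + (size p).-1) a -> vanish N (coef_op a).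
Proof.
move=> va k kN; rewrite /coef_op /coef_diff_poly big1 ?mulr0 // => j _.
rewrite (@vanish_iter_deriv_seq _ j N) ?mulr0 //; apply: vanishW va.
by rewrite leq_add2l -ltnS prednK // ltnW.
Qed.

Lemma vanish_iter_op n N a : vanish (N + n * (size p).-1) a -> vanish N (iter n coef_op a).
Proof.
elim: n N => [|n IH] N /=; first by rewrite mul0n addn0.
by rewrite mulSn addnA => /IH; apply: vanish_op.
Qed.

Lemma deriv_seqD j a b k : iter j (@deriv_seq R) (fun k => a k + b k) k =
  iter j (@deriv_seq R) a k + iter j (@deriv_seq R) b k.
Proof. by elim: j k => //= j IH k; rewrite /deriv_seq IH mulrDr. Qed.

Lemma iter_opD n a b k : iter n coef_op (fun k => a k + b k) k =
  iter n coef_op a k + iter n coef_op b k.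
Proof.
elim: n k => //= n IH k.
have -> : iter n coef_op (fun k => a k + b k) =
  (fun k => iter n coef_op a k + iter n coef_op b k) by apply/funext.
rewrite /coef_op -mulrDr /coef_diff_poly -big_split /=; congr (_ * _).
by apply: eq_bigr => j _; rewrite deriv_seqD mulrDr.
Qed.

(** The factor by which p(D) expands vectors vanishing to high order. *)
Definition half_lead : R := cabs (lead_coef p) / 2.

Lemma lead_gt0 : 0 < cabs (lead_coef p).
Proof. by rewrite cabs_gt0 lead_coef_eq0 -size_poly_eq0 -lt0n ltnW. Qed.

Lemma half_lead_gt0 : 0 < half_lead.
Proof. by rewrite divr_gt0 ?lead_gt0. Qed.

(** If a vanishes to high order, each differentiation enlarges the norm by a factor
    at least 1 / delta, so all lower-order terms of p(D) a together weigh at most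
    half as much as the leading one. *)
Lemma diff_poly_expanding r : 0 < r -> exists N, forall a, rapid a -> vanish N a ->
  half_lead * coef_norm r a <= coef_norm r (coef_diff_poly a).
Proof.
move=> r0; pose d := (size p).-1.
have sd : size p = d.+1 by rewrite prednK // ltnW.
pose S := \sum_(j < d) cabs p`_j.
have S0 : 0 <= S by apply: sumr_ge0 => j _; apply: cabs_ge0.
pose delta := Num.min 1 (half_lead / (S + 1)).
have e0 := half_lead_gt0.
have d0 : 0 < delta by rewrite lt_min ltr01 divr_gt0 //; lra.
have d1 : delta <= 1 by rewrite ge_min lexx.
have d2 : delta * (S + 1) <= half_lead.
  by rewrite -ler_pdivlMr; [rewrite ge_min lexx orbT | lra].
pose m := (Num.truncn (r / delta)).+1.
have hm : r / m%:R <= delta.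
  rewrite ler_pdivrMr ?ltr0n // mulrC -ler_pdivrMr // ltW //.
  exact: truncnS_gt.
exists (m + d)%N => a ra va.
pose D j := iter j (@deriv_seq R) a.
have rD j : rapid (D j) by exact: rapid_iter_deriv_seq.
have step j : (j < d)%N -> coef_norm r (D j) <= delta * coef_norm r (D j.+1).
  move=> jd; have vD : vanish m (D j).
    apply: vanish_iter_deriv_seq; apply: vanishW va; by rewrite leq_add2l ltnW.
  apply: le_trans (coef_norm_deriv_seq_ge r0 _ (rD j) vD) _ => //.
  by rewrite ler_wpM2r // coef_norm_ge0 ?ltW //; apply: (rD j.+1).
set W := coef_norm r (D d).
have W0 : 0 <= W by apply: coef_norm_ge0 (ltW r0) (rD d).
(* Downward induction from the leading term, using delta <= 1. *)
have chain i : (i < d)%N -> coef_norm r (D (d - i.+1)%N) <= delta * W.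
  elim: i => [|i IH] id.
    by have := step (d - 1)%N; rewrite subn1 prednK //; apply; rewrite leqnn.
  apply: le_trans (step _ _) _; first by rewrite ltn_subrL /= (leq_ltn_trans _ id).
  rewrite -subSn // subSS ler_wpM2l ?(ltW d0) //.
  apply: le_trans (IH (ltnW id)) _; nra.
have low j : (j < d)%N -> coef_norm r (D j) <= delta * W.
  move=> jd; have := chain (d - j.+1)%N.
  by rewrite subnSK // subKn ?(ltnW jd) //; apply; rewrite leq_subr.
have d_gt0 : (0 < d)%N by rewrite -ltnS -sd.
have aW : coef_norm r a <= W by apply: le_trans (low 0%N d_gt0) _; nra.
set V := coef_norm r (coef_diff_poly a).
have main : cabs (lead_coef p) * W <= V + S * (delta * W).
  rewrite -ler_pdivlMl ?lead_gt0 //; apply: coef_norm_le => k.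
  rewrite ler_pdivlMl ?lead_gt0 // mulrA -cabsM.
  have -> : lead_coef p * D d k = coef_diff_poly a k - \sum_(j < d) p`_j * D j k.
    by rewrite /coef_diff_poly sd big_ord_recr /= [RHS]addrAC subrr add0r.
  apply: le_trans (ler_wpM2r (exprn_ge0 _ (ltW r0)) (cabsB _ _)) _.
  rewrite mulrDl lerD ?coef_norm_ge ?(ltW r0) //; first exact: rapid_diff_poly.
  apply: le_trans (ler_wpM2r (exprn_ge0 _ (ltW r0)) (cabs_sum _ _ _)) _.
  rewrite !mulr_suml; apply: ler_sum => j _; rewrite cabsM -mulrA ler_wpM2l ?cabs_ge0 //.
  by apply: le_trans (low j (ltn_ord j)); apply: coef_norm_ge; rewrite ?ltW.
have : delta * (S + 1) * W <= half_lead * W by rewrite ler_wpM2r.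
have : half_lead * coef_norm r a <= half_lead * W by rewrite ler_wpM2l // ltW.
have : 0 <= delta * W by rewrite mulr_ge0 // ltW.
by move: main; rewrite /half_lead; lra.
Qed.

(** A dilation is a change of radius. *)
Lemma coef_norm_op s a : coef_norm s (coef_op a) = coef_norm (cabs lambda * s) (coef_diff_poly a).
Proof.
rewrite /coef_norm; suff -> : (fun k => cabs (coef_op a k) * s ^+ k) =
  (fun k => cabs (coef_diff_poly a k) * (cabs lambda * s) ^+ k) by [].
by apply/funext => k; rewrite /coef_op cabsM cabsX exprMn [cabs lambda ^+ k * _]mulrC -mulrA.
Qed.

Hypothesis lambda_gt0 : 0 < cabs lambda.

Lemma iter_op_expanding n s : 0 < s -> exists N, forall a, rapid a -> vanish N a ->
  half_lead ^+ n * coef_norm (cabs lambda ^+ n * s) a <= coef_norm s (iter n coef_op a).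
Proof.
elim: n s => [|n IH] s s0 /=.
  by exists 0%N => a _ _; rewrite !expr0 !mul1r.
have ls : 0 < cabs lambda * s by rewrite mulr_gt0.
have [N1 H1] := IH _ ls; have [N2 H2] := diff_poly_expanding ls.
exists (maxn N1 (N2 + n * (size p).-1)) => a ra va.
rewrite coef_norm_op; apply: le_trans (H2 _ _ _); last 2 first.
- exact: rapid_iter_op.
- by apply: vanish_iter_op; apply: vanishW va; rewrite leq_maxr.
rewrite exprS -mulrA ler_wpM2l ?(ltW half_lead_gt0) // exprSr -mulrA.
by apply: H1 => //; apply: vanishW va; rewrite leq_maxl.
Qed.

(** The factor 2^N gained between the radii |lambda|^n / 2 and |lambda|^n absorbs
    both K and the n-th power of the expansion constant, which are fixed before
    N. *)
Lemma high_order_dominates n (K : R) : exists N, forall a, rapid a -> vanish N a ->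
  iter n coef_op a 0%N = 0 /\
  K * coef_norm (cabs lambda ^+ n / 2) a <= coef_norm 1 (iter n coef_op a).
Proof.
have [N1 H1] := iter_op_expanding n ltr01.
have [N2 H2] := half_pow_small K (exprn_gt0 n half_lead_gt0).
exists (maxn N1 (maxn N2 (1 + n * (size p).-1))) => a ra va; split.
  apply: (@vanish_iter_op n 1) => //; apply: vanishW va.
  by rewrite !leq_max leqnn !orbT.
have ln : 0 < cabs lambda ^+ n by rewrite exprn_gt0.
apply: le_trans (H1 a ra _); last by apply: vanishW va; rewrite leq_maxl.
rewrite mulr1; have := @coef_norm_half _ N2 _ a ln ra.
have W0 := coef_norm_ge0 (ltW ln) ra.
have Wh : 0 <= coef_norm (cabs lambda ^+ n / 2) a.
  by apply: coef_norm_ge0 => //; rewrite divr_ge0 // ltW.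
move=> /(_ ltac:(by apply: vanishW va; rewrite !leq_max leqnn !orbT)) H.
have := ler_wpM2l (exprn_ge0 n (ltW half_lead_gt0)) H.
apply: le_trans; rewrite mulrA ler_wpM2r //.
by move: H2; rewrite exprVn ltr_pdivrMr ?exprn_gt0 // => /ltW.
Qed.

End OperatorOnCoefficients.

(** * Taylor coefficients of entire functions *)

Section TaylorCoefficients.
Variable R : realType.
Implicit Types (f g : R[i] -> R[i]) (a b : nat -> R[i]) (z : R[i]).

Lemma pseries_sum0 a f : pseries_sum a f -> f 0 = a 0%N.
Proof.
move=> /(_ 0) af; apply: has_sum_unique af _.
have := @has_sum_finite R (fun k => a k * 0 ^+ k) 1.
rewrite big_ord1 expr0 mulr1; apply=> -[//|k] _.
by rewrite exprS mul0r mulr0.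
Qed.

Lemma pseries_derive1 a f : rapid a -> pseries_sum a f ->
  pseries_sum (deriv_seq a) (derive1 f).
Proof.
move=> ra af; have [g dg] := pseries_sum_exists (rapid_deriv_seq ra).
have -> : derive1 f = g; last by [].
by apply/funext => z; apply: derive1_cderiv; apply: pseries_cderiv af dg.
Qed.

Lemma pseries_derivable a f z : rapid a -> pseries_sum a f -> derivable f z 1.
Proof.
move=> ra af; have [g dg] := pseries_sum_exists (rapid_deriv_seq ra).
by apply/derivableP_cderiv; exists (g z); apply: pseries_cderiv af dg.
Qed.

Lemma pseries_derive1n n a f : rapid a -> pseries_sum a f ->
  pseries_sum (iter n (@deriv_seq R) a) (derive1n n f).
Proof.
move=> ra af; elim: n => [|n IH] //=; rewrite /derive1n /=.
by apply: pseries_derive1 IH; exact: rapid_iter_deriv_seq.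
Qed.

Lemma pseries_sum_add a b f g : pseries_sum a f -> pseries_sum b g ->
  pseries_sum (fun k => a k + b k) (fun z => f z + g z).
Proof.
move=> af bg z; apply: has_sum_eq (has_sum_add (af z) (bg z)) => k.
by rewrite mulrDl.
Qed.

Lemma pseries_sum_scale (l : R[i]) a f : pseries_sum a f ->
  pseries_sum (fun k => l * a k) (fun z => l * f z).
Proof.
by move=> af z; apply: has_sum_eq (has_sum_scale l (af z)) => k; rewrite mulrA.
Qed.

Lemma pseries_sum_zero : pseries_sum (fun=> 0) (fun=> 0 : R[i]).
Proof.
move=> z e e0; exists 0%N => n _; rewrite big1 ?subrr ?cabs0 ?ltW // => k _.
by rewrite mul0r.
Qed.

Lemma pseries_sum_big n (u : nat -> nat -> R[i]) (F : nat -> R[i] -> R[i]) :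
  (forall j, pseries_sum (u j) (F j)) ->
  pseries_sum (fun k => \sum_(j < n) u j k) (fun z => \sum_(j < n) F j z).
Proof.
move=> uF; elim: n => [|n IH].
  have := pseries_sum_zero; congr pseries_sum; apply/funext => k; by rewrite big_ord0.
have := pseries_sum_add IH (uF n); congr pseries_sum; apply/funext => k;
  by rewrite big_ord_recr.
Qed.

Lemma pseries_op (lambda : R[i]) (p : {poly R[i]}) a f : rapid a -> pseries_sum a f ->
  pseries_sum (coef_op lambda p a) ((dilation lambda \o diff_poly p) f).
Proof.
move=> ra af z; have := @pseries_sum_big (size p)
  (fun j k => p`_j * iter j (@deriv_seq R) a k) (fun j z => p`_j * derive1n j f z)
  (fun j => pseries_sum_scale p`_j (pseries_derive1n j ra af)) (lambda * z).
apply: has_sum_eq => k; rewrite /coef_op /coef_diff_poly exprMn.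
by rewrite mulrA [_ * lambda ^+ k]mulrC.
Qed.

Lemma pseries_iter_op (lambda : R[i]) (p : {poly R[i]}) n a f :
  rapid a -> pseries_sum a f ->
  pseries_sum (iter n (coef_op lambda p) a) (iter n (dilation lambda \o diff_poly p) f).
Proof.
by move=> ra af; elim: n => //= n; apply: pseries_op; exact: rapid_iter_op.
Qed.

(** The constant coefficient is the value at 0; differentiate and repeat. *)
Lemma pseries_coef0 k a : rapid a -> pseries_sum a (fun=> 0) -> a k = 0.
Proof.
elim: k a => [|k IH] a ra a0; first by rewrite -(pseries_sum0 a0).
have /IH : rapid (deriv_seq a) by exact: rapid_deriv_seq.
have := pseries_derive1 ra a0.
have -> : derive1 (fun=> 0 : R[i]) = (fun=> 0 : R[i]).
  apply/funext => z; apply: derive1_cderiv => e e0; exists 1 => // w _.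
  by rewrite subrr mul0r subrr cabs0 mulr_ge0 ?cabs_ge0 ?ltW.
by move=> H /(_ H) /eqP; rewrite /deriv_seq mulf_eq0 pnatr_eq0 /= => /eqP.
Qed.

Lemma pseries_unique a b f : rapid a -> rapid b ->
  pseries_sum a f -> pseries_sum b f -> a = b.
Proof.
move=> ra rb af bf; apply/funext => k; apply/eqP; rewrite -subr_eq0; apply/eqP.
have := @pseries_coef0 k (fun k => a k + -1 * b k)
  (rapid_add ra (rapid_scale (-1) rb)).
rewrite mulN1r; apply; have := pseries_sum_add af (pseries_sum_scale (-1) bf).
by congr pseries_sum; apply/funext => z; rewrite mulN1r subrr.
Qed.

Lemma entire_cderiv (f : entire_fun R) z : exists l, has_cderiv f z l.
Proof.
by apply/derivableP_cderiv; have /asboolP := entire_valP f; apply.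
Qed.

Definition taylor_coef (f : entire_fun R) : nat -> R[i] :=
  sval (cid (entire_taylor (entire_cderiv f))).

Lemma taylor_coef_rapid (f : entire_fun R) : rapid (taylor_coef f).
Proof. by rewrite /taylor_coef; case: cid => a []. Qed.

Lemma taylor_coef_sum (f : entire_fun R) : pseries_sum (taylor_coef f) f.
Proof. by rewrite /taylor_coef; case: cid => a []. Qed.

Lemma taylor_coef_le (f : entire_fun R) (M : R) k :
  (forall x y, `|x| <= 1 -> `|y| <= 1 -> cabs (f (x +i* y)%C) <= M) ->
  cabs (taylor_coef f k) <= 4 * M.
Proof. by rewrite /taylor_coef; case: cid => a [_ _ H] /= /H. Qed.

Lemma taylor_coef_unique (f : entire_fun R) a : rapid a -> pseries_sum a f -> taylor_coef f = a.
Proof. by move=> ra af; exact: pseries_unique (taylor_coef_rapid f) ra (taylor_coef_sum f) af. Qed.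

Lemma entire_fun_inj (f g : entire_fun R) : (forall z, f z = g z) -> f = g.
Proof. by move=> fg; apply: val_inj; apply/funext. Qed.

Lemma taylor_coefD (f g : entire_fun R) k :
  taylor_coef (f + g) k = taylor_coef f k + taylor_coef g k.
Proof.
rewrite (@taylor_coef_unique (f + g) (fun k => taylor_coef f k + taylor_coef g k)) //.
  exact: rapid_add (taylor_coef_rapid f) (taylor_coef_rapid g).
exact: pseries_sum_add (taylor_coef_sum f) (taylor_coef_sum g).
Qed.

Lemma taylor_coefZ (l : R[i]) (f : entire_fun R) k : taylor_coef (l *: f) k = l * taylor_coef f k.
Proof.
rewrite (@taylor_coef_unique (l *: f) (fun k => l * taylor_coef f k)) //.
  exact: rapid_scale (taylor_coef_rapid f).
exact: pseries_sum_scale (taylor_coef_sum f).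
Qed.

Lemma taylor_coef0 k : taylor_coef 0 k = 0.
Proof.
by rewrite (@taylor_coef_unique 0 (fun=> 0)) //; [exact: rapid0 | exact: pseries_sum_zero].
Qed.

Lemma taylor_coef_eq0 (f : entire_fun R) : (forall k, taylor_coef f k = 0) -> f = 0.
Proof.
move=> f0; apply: entire_fun_inj => z.
apply: has_sum_unique (taylor_coef_sum f z) _; rewrite (funext f0).
exact: pseries_sum_zero.
Qed.

Lemma entire_of_rapid a : rapid a -> exists f : entire_fun R, taylor_coef f = a.
Proof.
move=> ra; have [f af] := pseries_sum_exists ra.
have fE : f \in @entire R.
  by apply/asboolP => z; exact: pseries_derivable af.
by exists (EntireFun fE); exact: taylor_coef_unique.
Qed.

End TaylorCoefficients.

(** * Subspaces separated by finitely many functionals *)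

Section FiniteDimension.
Variables (K : fieldType) (V : lmodType K) (phi : nat -> V -> K).
Hypothesis phi_lin : forall k l u v, phi k (l *: u + v) = l * phi k u + phi k v.

(** By induction on N: on the kernel of the last functional the others separate
    points, and this kernel has codimension at most 1 in M. *)
Lemma finite_dimensional_of_functionals N (M : set V) : linear_subspace M ->
  (forall v, M v -> (forall k, (k < N)%N -> phi k v = 0) -> v = 0) ->
  finite_dimensional M.
Proof.
have phi0 k : phi k 0 = 0.
  by have := phi_lin k (-1) 0 0; rewrite scaler0 addr0 mulN1r addNr.
elim: N M => [|N IH] M [] /set_mem M0 Mlin sep.
  exists 0%N, (fun=> 0); apply/seteqP; split => v.
    by move=> Mv; exists (fun=> 0); rewrite big_ord0; apply: sep.
  by move=> [c ->]; rewrite big_ord0.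
have MP l u v : M u -> M v -> M (l *: u + v).
  by move=> Mu Mv; apply/set_mem; apply: Mlin; apply/mem_set.
pose M' := [set v | M v /\ phi N v = 0].
have [] := IH M'.
- split; first by apply/mem_set; split.
  move=> l u v /set_mem[Mu u0] /set_mem[Mv v0]; apply/mem_set; split; first exact: MP.
  by rewrite phi_lin u0 v0 mulr0 addr0.
- move=> v [Mv v0] Hv; apply: sep => // k; rewrite ltnS leq_eqVlt.
  by case/predU1P => [->|/Hv].
move=> n [e eP].
case: (pselect (exists u, M u /\ phi N u != 0)) => [[u [Mu u0]]|no]; last first.
  exists n, e; rewrite -eP; apply/seteqP; split => v; last by case.
  move=> Mv; split=> //; apply: contrapT => /eqP v0; apply: no; by exists v.
exists n.+1, (fun i => if unlift ord0 i is Some j then e j else u).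
apply/seteqP; split => v.
  move=> Mv; pose l := phi N v / phi N u.
  have : M' (- l *: u + v).
    split; first exact: MP.
    by rewrite phi_lin mulNr /l divfK // addNr.
  rewrite eP => -[c cE].
  exists (fun i => if unlift ord0 i is Some j then c j else l).
  rewrite big_ord_recl /= unlift_none; under eq_bigr do rewrite !liftK.
  by rewrite -cE scaleNr addrA subrr add0r.
case=> c ->; rewrite big_ord_recl unlift_none; under eq_bigr do rewrite liftK.
apply: MP => //.
have : M' (\sum_(i < n) c (lift ord0 i) *: e i) by rewrite eP; exists (fun i => c (lift ord0 i)).
by case.
Qed.

End FiniteDimension.

(** * The compact-open topology *)

Section CompactOpen.
Variable R : realType.
Implicit Types (f g : entire_fun R) (u : nat -> entire_fun R).

Definition locally_uniform_limit u f := forall r e : R, 0 < e ->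
  exists N, forall n, (N <= n)%N -> forall z, cabs z <= r -> cabs (u n z - f z) <= e.

(** By compactness it suffices to find, around each point of K, a neighbourhood
    that all u n with n large map into the given open set. *)
Lemma locally_uniform_cvg u f : locally_uniform_limit u f -> u @ \oo --> f.
Proof.
move=> uf B [_ [[V oV <-] Vf VB]].
have cv : (fun n => entire_val (u n)) @ \oo --> (entire_val f : {compact-open, R[i] -> R[i]}).
  apply/compact_open_cvgP => K Q cK oQ fKQ.
  have /compact_near_coveringP/(_ nat \oo (fun n z => Q (u n z))) := cK.
  case=> [z Kz|N _ HN]; last first.
    by exists N => // n /HN H _ [z Kz <-]; exact: H.
  have Qz : Q (f z) by apply: fKQ; exists z.
  have /near_complexP[e e0 He] : \forall w \near f z, Q w by exact: open_nbhs_nbhs.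
  have [l fl] := entire_cderiv f z.
  have [d d0 Hd] := cderiv_cont fl (e := e / 3) ltac:(lra).
  have [N HN] := uf (cabs z + d) (e / 3) ltac:(lra).
  exists ([set w | cabs (w - z) < d], [set n | (N <= n)%N]).
    by split; [apply/near_complexP; exists d | exists N].
  move=> [w n] [/= wz Nn]; apply: He.
  have := HN n Nn w; have := Hd w wz.
  have -> : u n w - f z = (u n w - f w) + (f w - f z) by ring.
  have wle : cabs w <= cabs z + d.
    by have := cabsD (w - z) z; rewrite subrK; lra.
  by move=> H1 /(_ wle) H2; apply: le_lt_trans (cabsD _ _) _; lra.
have : nbhs (entire_val f : {compact-open, R[i] -> R[i]}) V by exact: open_nbhs_nbhs.
move=> /cv [N _ HN]; exists N => // n /HN; exact: VB.
Qed.

Lemma closed_locally_uniform (M : set (entire_fun R)) u f : closed M ->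
  (forall n, M (u n)) -> locally_uniform_limit u f -> M f.
Proof.
move=> cM Mu /locally_uniform_cvg uf.
apply: (closed_cvg M cM _ _ uf); exact: nearW.
Qed.

(** The functions that map the compact unit square into a given neighbourhood
    of 1 form an open set in the compact-open topology. *)
Lemma dense_near_constant_one (S : set (entire_fun R)) (e : R) : dense S -> 0 < e ->
  exists2 g, S g & forall x y, `|x| <= 1 -> `|y| <= 1 -> cabs (g (x +i* y)%C - 1) <= e.
Proof.
move=> dS e0.
pose K : set R[i] := (fun q : R * R => (q.1 +i* q.2)%C) @` (`[- 1, 1] `*` `[- 1, 1]).
have cK : compact K.
  apply: continuous_compact; last by apply: compact_setX; apply: segment_compact.
  apply: continuous_subspaceT => -[x y] B /near_complexP[d d0 Hd].
  have d2 : 0 < d / 2 by rewrite divr_gt0.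
  exists (ball x (d / 2), ball y (d / 2)); first by split; exact: nbhsx_ballx.
  move=> -[x' y'] [] /=; rewrite /ball /= => bx by_; apply: Hd.
  apply: le_lt_trans (cabs_le_ReIm _) _ => /=.
  by rewrite distrC [`|y' - y|]distrC; lra.
pose O : set R[i] := interior [set w | cabs (w - 1) <= e].
pose U := (@entire_val R) @^-1` [set g | g @` K `<=` O].
have oU : open (U : set (entire_fun R)).
  exists [set g | g @` K `<=` O] => //.
  by apply: compact_open_open => //; exact: open_interior.
have oneE : (fun=> 1 : R[i]) \in @entire R.
  by apply/asboolP => z; exact: derivable_cst.
have [|g [Ug Sg]] := dS U _ oU.
  exists (EntireFun oneE) => _ [z _ <-] /=.
  apply/near_complexP; exists e => // w /ltW; exact.
exists g => // x y xr yr.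
apply: (@interior_subset _ [set w | cabs (w - 1) <= e]).
apply: Ug; exists (x +i* y)%C => //; exists (x, y) => //.
by split; rewrite /= in_itv /= -ler_norml.
Qed.

End CompactOpen.

Lemma quarter_pow_le_half (R : realType) m n : (m <= n)%N ->
  4^-1 ^+ n <= 2^-1 ^+ m :> R.
Proof.
move=> mn; apply: (@le_trans _ _ (2^-1 ^+ n)).
  by apply: lerXn2r; rewrite ?nnegrE ?invr_ge0 ?ler0n // lef_pV2 ?posrE ?ltr0n // ler_nat.
by apply: ler_wiXn2l; rewrite ?invr_ge0 ?ler0n ?invf_le1 ?ltr0n ?ler1n.
Qed.

(** * The series in a large subspace *)

Section Construction.
Variables (R : realType) (lambda : R[i]) (p : {poly R[i]}).
Hypothesis hp : (1 < size p)%N.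
Hypothesis lambda_gt1 : 1 < cabs lambda.
Variable M : set (entire_fun R).
Hypothesis Mlin : linear_subspace M.
Hypothesis Mclosed : closed M.
Hypothesis Mlarge : forall N, exists f, [/\ M f, f != 0 & vanish N (taylor_coef f)].

Local Notation L := (coef_op lambda p).
Local Notation radius n := (cabs lambda ^+ n / 2).

Let lambda_gt0 : 0 < cabs lambda.
Proof. by apply: lt_trans lambda_gt1. Qed.

Let radius_gt0 n : 0 < radius n.
Proof. by rewrite divr_gt0 ?exprn_gt0. Qed.

Let M_lin l u v : M u -> M v -> M (l *: u + v).
Proof.
by case: Mlin => _ H Mu Mv; apply/set_mem; apply: H; apply/mem_set.
Qed.

Let M0 : M 0.
Proof. by case: Mlin => /set_mem. Qed.

(** What is required of the n-th summand e, where x is the sum of the previous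
    ones and m the order of vanishing already reached: any vector a vanishing to
    order N, in particular the tail starting with e, has an image under L^n
    that dominates L^n x.  The constant 6 * 4^n makes the image at least 3 times as
    large as L^n x when the norm of a for [radius n] is at least 4^-n / 2. *)
Definition block_spec n x m e N := [/\ M e, (m <= N)%N, (n < N)%N,
  vanish N (taylor_coef e) & coef_norm (radius n) (taylor_coef e) = 4^-1 ^+ n /\
  forall a, rapid a -> vanish N a -> iter n L a 0%N = 0 /\
    6 * 4 ^+ n * coef_norm 1 (iter n L (taylor_coef x)) * coef_norm (radius n) a
       <= coef_norm 1 (iter n L a)].

(** A vector of M vanishing to high enough order, normalised. *)
Lemma next_block n x m : exists eN, block_spec n x m eN.1 eN.2.
Proof.
have [N1 H1] := high_order_dominates hp lambda_gt0 n
  (6 * 4 ^+ n * coef_norm 1 (iter n L (taylor_coef x))).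
pose N := maxn N1 (maxn m n.+1).
have [f [Mf f0 vf]] := Mlarge N.
have rf := taylor_coef_rapid f.
have W0 := coef_norm_ge0 (ltW (radius_gt0 n)) rf.
have W : 0 < coef_norm (radius n) (taylor_coef f).
  rewrite lt_neqAle W0 andbT eq_sym; apply/eqP => W; move/eqP: f0; apply.
  apply: taylor_coef_eq0 => k; apply/eqP; rewrite -cabs_eq0.
  have := coef_norm_ge k (ltW (radius_gt0 n)) rf; rewrite W pmulr_lle0 ?exprn_gt0 //.
  by move=> ?; rewrite eq_le cabs_ge0 andbT.
pose c : R := 4^-1 ^+ n / coef_norm (radius n) (taylor_coef f).
have c0 : 0 < c by rewrite divr_gt0 ?exprn_gt0.
exists ((c%:C)%C *: f, N); split => /=.
- by rewrite -[_ *: _]addr0; apply: M_lin.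
- by rewrite !leq_max leqnn orbT.
- by rewrite !leq_max leqnn !orbT.
- by move=> k kN; rewrite taylor_coefZ vf ?mulr0.
split; last by move=> a ra va; apply: H1 => //; apply: vanishW va; rewrite leq_maxl.
apply/eqP; rewrite eq_le; apply/andP; split.
  apply: coef_norm_le => k; rewrite taylor_coefZ cabsM cabs_real (gtr0_norm c0) -mulrA.
  rewrite /c mulrAC ler_pdivrMr // ler_wpM2l ?exprn_ge0 //.
  exact: coef_norm_ge (ltW (radius_gt0 n)) rf.
have -> : 4^-1 ^+ n = c * coef_norm (radius n) (taylor_coef f) by rewrite /c divfK ?gt_eqF.
rewrite -ler_pdivlMl //.
apply: coef_norm_le => k; rewrite ler_pdivlMl // mulrA.
have := coef_norm_ge k (ltW (radius_gt0 n)) (taylor_coef_rapid ((c%:C)%C *: f)).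
by rewrite taylor_coefZ cabsM cabs_real (gtr0_norm c0).
Qed.

Lemma radius_unbounded r : exists n, r <= radius n.
Proof.
have : geometric 1 (cabs lambda)^-1 @ \oo --> (0 : R).
  by apply: cvg_geometric; rewrite ger0_norm ?invr_ge0 ?cabs_ge0 // invf_lt1.
have e0 : 0 < (2 * (`|r| + 1))^-1 by rewrite invr_gt0 mulr_gt0 // ltr_wpDl.
move=> /cvgrPdist_le /(_ _ e0)[n _ /(_ n (leqnn n))] /=.
rewrite sub0r normrN mul1r ger0_norm ?exprn_ge0 ?invr_ge0 ?(ltW lambda_gt0) //.
rewrite exprVn lef_pV2 ?posrE ?exprn_gt0 // ?mulr_gt0 ?ltr_wpDl // => H.
by exists n; have := ler_norm r; lra.
Qed.

Lemma block_sequence : exists (e x : nat -> entire_fun R) (N : nat -> nat),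
  [/\ x 0%N = 0, forall n, x n.+1 = x n + e n, forall n, (N n <= N n.+1)%N &
   forall n, block_spec n (x n) 0 (e n) (N n)].
Proof.
have [F FP] := choice (fun q : nat * (entire_fun R * nat) =>
  next_block q.1 q.2.1 q.2.2).
pose s := fix s n := if n is k.+1 then ((s k).1 + (F (k, s k)).1, (F (k, s k)).2)
  else (0, 0%N).
exists (fun n => (F (n, s n)).1), (fun n => (s n).1), (fun n => (F (n, s n)).2).
split=> // n; first by have [] := FP (n.+1, s n.+1).
by have [? ? ? ? ?] := FP (n, s n); split.
Qed.

(** Here f is the sum of the blocks e n, x n their partial sum and y n the tail.
    Since e n vanishes to an order larger than n, each Taylor coefficient of f is
    a finite sum.  The tail norm is at least
    4^-n - (4^-(n+1) + 4^-(n+2) + ...) = (2/3) 4^-n. *)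
Lemma block_series_escapes : exists f, [/\ M f, f != 0 &
  forall n, 2 * cabs (iter n L (taylor_coef f) 0%N) <= coef_norm 1 (iter n L (taylor_coef f))].
Proof.
have [e [x [N [x0 xS NS spec]]]] := block_sequence.
pose E n k := taylor_coef (e n) k; pose X n k := taylor_coef (x n) k.
have XS n k : X n.+1 k = X n k + E n k by rewrite /X xS taylor_coefD.
have EN n k : (k < N n)%N -> E n k = 0 by case: (spec n) => _ _ _ + _; apply.
have nN n : (n < N n)%N by case: (spec n).
have Mx n : M (x n).
  elim: n => [|n IH]; first by rewrite x0.
  by rewrite xS -[x n]scale1r; apply: M_lin => //; case: (spec n).
have Nmono i j : (N i <= N (i + j))%N.
  by elim: j => [|j IH]; rewrite ?addn0 // addnS (leq_trans IH).
(* The coefficients of f: blocks with index above k do not contribute to the k-th. *)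
pose s k := X k.+1 k.
have Xs n k : (k < n)%N -> X n k = s k.
  elim: n => // n IH; rewrite ltnS leq_eqVlt => /predU1P[->//|kn].
  by rewrite XS IH // EN ?addr0 // (ltn_trans kn).
have rmono i j : radius i <= radius (i + j).
  rewrite ler_pM2r // exprD ler_peMr ?exprn_ge0 ?(ltW lambda_gt0) //.
  by rewrite exprn_ege1 // ltW.
have Ebd n k : cabs (E n k) * radius n ^+ k <= 4^-1 ^+ n.
  case: (spec n) => _ _ _ _ [<- _].
  exact: coef_norm_ge (ltW (radius_gt0 n)) (taylor_coef_rapid (e n)).
have powmono i j k : radius i ^+ k <= radius (i + j) ^+ k.
  by rewrite lerXn2r ?nnegrE ?(ltW (radius_gt0 _)).
have partial n j k : cabs (X (n + j)%N k - X n k) * radius n ^+ k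
    <= 4 / 3 * (4^-1 ^+ n - 4^-1 ^+ (n + j)).
  elim: j => [|j IH]; first by rewrite addn0 !subrr cabs0 mul0r mulr0.
  rewrite addnS XS [X in cabs X](_ : _ = (X (n + j)%N k - X n k) + E (n + j)%N k); last by ring.
  have r0 : 0 <= radius n ^+ k by rewrite exprn_ge0 // ltW.
  apply: le_trans (ler_wpM2r r0 (cabsD _ _)) _.
  have : cabs (E (n + j)%N k) * radius n ^+ k <= 4^-1 ^+ (n + j).
    apply: le_trans (Ebd (n + j)%N k).
    by rewrite ler_wpM2l ?cabs_ge0.
  by rewrite mulrDl exprS; move: IH; lra.
pose y n k := s k - X n k.
have ybd n k : cabs (y n k) * radius n ^+ k <= 4 / 3 * 4^-1 ^+ n.
  rewrite /y -(Xs (n + k.+1)%N) ?ltn_addl //.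
  apply: le_trans (partial n k.+1 k) _.
  have : 0 < (4^-1 : R) ^+ (n + k.+1) by rewrite exprn_gt0.
  by lra.
have sE n k : s k = X n k + y n k by rewrite /y addrC subrK.
have rs : rapid s.
  move=> r r0; have [n rn] := radius_unbounded r.
  have [C XC] := taylor_coef_rapid (x n) r0.
  exists (C + 4 / 3 * 4^-1 ^+ n) => k; rewrite (sE n).
  apply: le_trans (ler_wpM2r (exprn_ge0 k r0) (cabsD _ _)) _.
  rewrite mulrDl lerD ?XC //; apply: le_trans (ybd n k).
  by rewrite ler_wpM2l ?cabs_ge0 // lerXn2r ?nnegrE // (le_trans r0).
have ry n : rapid (y n).
  have := rapid_add rs (rapid_scale (-1) (taylor_coef_rapid (x n))).
  by congr rapid; apply/funext => k; rewrite mulN1r.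
have [f fs] := entire_of_rapid rs.
have vy n : vanish (N n) (y n).
  move=> k kN; rewrite /y -(Xs (n + k.+1)%N) ?ltn_addl //.
  elim: k.+1 => [|j IH]; first by rewrite addn0 subrr.
  rewrite addnS XS addrAC IH add0r EN // (leq_trans kN) //.
(* The triangle inequality for e n = y n - y n.+1, the latter being small
   already at the larger radius of index n.+1. *)
have ylow n : 4^-1 ^+ n / 2 <= coef_norm (radius n) (y n).
  have : 4^-1 ^+ n <= coef_norm (radius n) (y n) + 4^-1 ^+ n / 3.
    case: (spec n) => _ _ _ _ [{1}<- _]; apply: coef_norm_le => k.
    rewrite -/(E n k) [X in cabs X](_ : _ = y n k - y n.+1 k); last first.
      by rewrite /y XS; ring.
    have r0 : 0 <= radius n ^+ k by rewrite exprn_ge0 // ltW.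
    apply: le_trans (ler_wpM2r r0 (cabsB _ _)) _; rewrite mulrDl lerD //.
      exact: coef_norm_ge (ltW (radius_gt0 n)) (ry n).
    have : cabs (y n.+1 k) * radius n ^+ k <= cabs (y n.+1 k) * radius n.+1 ^+ k.
      by rewrite ler_wpM2l ?cabs_ge0 //; have := powmono n 1%N k; rewrite addn1.
    by have := ybd n.+1 k; rewrite [4^-1 ^+ n.+1]exprS; lra.
  have : 0 < (4^-1 : R) ^+ n by rewrite exprn_gt0.
  by lra.
exists f; split.
- apply: (closed_locally_uniform Mclosed Mx) => r d d0.
  have [n1 H1] := radius_unbounded (2 * `|r|).
  have [n2 H2] := half_pow_small (8 / 3) d0.
  exists (maxn n1 n2) => n; rewrite geq_max => /andP[n1n n2n] z zr.
  have halves := quarter_pow_le_half R n2n.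
  have ps : pseries_sum (y n) (fun z => f z + -1 * x n z).
    have := pseries_sum_add (taylor_coef_sum f) (pseries_sum_scale (-1) (taylor_coef_sum (x n))).
    by congr pseries_sum; apply/funext => k; rewrite fs mulN1r.
  have small k : cabs (y n k) * (2 * `|r|) ^+ k <= 4 / 3 * 2^-1 ^+ n2.
    apply: le_trans (_ : 4 / 3 * 4^-1 ^+ n <= _).
      apply: le_trans (ybd n k); rewrite ler_wpM2l ?cabs_ge0 //.
      apply: lerXn2r; rewrite ?nnegrE; first by rewrite mulr_ge0.
        exact: ltW (radius_gt0 n).
      by apply: le_trans H1 _; rewrite -(subnKC n1n).
    by rewrite ler_wpM2l.
  rewrite cabs_distC -mulN1r.
  apply: le_trans (pseries_sum_le (normr_ge0 r) small ps (le_trans zr (ler_norm r))) _.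
  by apply: le_trans (ltW H2); rewrite mulrA [2 * _](_ : _ = 8 / 3) //; field.
- apply/eqP => f0; have := ylow 0%N; rewrite expr0.
  have -> : y 0%N = (fun=> 0).
    apply/funext => k; rewrite /y -fs f0 /X x0 !taylor_coef0 subrr //.
  have : coef_norm (radius 0) (fun=> 0 : R[i]) <= 0.
    by apply: coef_norm_le => k; rewrite cabs0 mul0r.
  by lra.
- move=> n; rewrite fs.
  have -> : s = (fun k => X n k + y n k) by apply/funext => k; exact: sE.
  have [yn0 ybig] : iter n L (y n) 0%N = 0 /\
    6 * 4 ^+ n * coef_norm 1 (iter n L (X n)) * coef_norm (radius n) (y n)
       <= coef_norm 1 (iter n L (y n)).
    by case: (spec n) => _ _ _ _ [_]; apply; [exact: ry | exact: vy].
  have rX : rapid (iter n L (X n)) by apply/rapid_iter_op/taylor_coef_rapid.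
  have ryL : rapid (iter n L (y n)) by apply/rapid_iter_op.
  set A := coef_norm 1 (iter n L (X n)) in ybig.
  have A0 : 0 <= A by apply: coef_norm_ge0.
  have XA : cabs (iter n L (X n) 0%N) <= A.
    by have := coef_norm_ge 0 ler01 rX; rewrite expr0 mulr1.
  have big : 3 * A <= coef_norm 1 (iter n L (y n)).
    apply: le_trans ybig; have := ylow n; rewrite exprVn => H.
    have q0 : 0 <= 6 * 4 ^+ n * A by rewrite !mulr_ge0 ?exprn_ge0.
    apply: le_trans (ler_wpM2l q0 H); rewrite le_eqVlt; apply/orP; left; apply/eqP.
    by field; rewrite expf_neq0.
  rewrite iter_opD yn0 addr0.
  have : coef_norm 1 (iter n L (y n)) <= coef_norm 1 (iter n L (fun k => X n k + y n k)) + A.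
    apply: coef_norm_le => k; rewrite expr1n mulr1.
    have := @iter_opD _ lambda p n (X n) (y n) k => Ek.
    have -> : iter n L (y n) k = iter n L (fun k => X n k + y n k) k - iter n L (X n) k.
      by rewrite Ek addrC addKr.
    apply: le_trans (cabsB _ _) _; apply: lerD.
      have := @coef_norm_ge R 1 (iter n L (fun k => X n k + y n k)) k ler01.
      rewrite expr1n mulr1; apply; apply: rapid_iter_op.
      exact: rapid_add (taylor_coef_rapid (x n)) (ry n).
    by have := coef_norm_ge k ler01 rX; rewrite expr1n mulr1.
  by lra.
Qed.

End Construction.

(** * Subspaces of supercyclic vectors *)

(** A multiple g of some iterate with |g - 1| <= 1/16 on the unit square has
    |g_k - 1_k| <= 1/4 for all coefficients, 1_k being those of the constant 1.
    So |g_0| >= 3/4, while |g_0| is at most half of the supremum of the |g_k|,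
    that is at most 5/8. *)
Lemma not_supercyclic_of_small_constant_term (R : realType) (lambda : R[i])
    (p : {poly R[i]}) (f : entire_fun R) :
  (forall n, 2 * cabs (iter n (coef_op lambda p) (taylor_coef f) 0%N) <=
     coef_norm 1 (iter n (coef_op lambda p) (taylor_coef f))) ->
  ~ supercyclic (dilation lambda \o diff_poly p) f.
Proof.
move=> small /dense_near_constant_one -/(_ (1 / 16)).
case=> [|g [mu [n gE]] gone]; first lra.
have rf := rapid_iter_op lambda p n (taylor_coef_rapid f).
have gc k : taylor_coef g k = mu * iter n (coef_op lambda p) (taylor_coef f) k.
  rewrite (@taylor_coef_unique _ g _ (rapid_scale mu rf)) // (_ : entire_val g = fun z =>
    mu * iter n (dilation lambda \o diff_poly p) f z); last exact/funext.
  exact/pseries_sum_scale/pseries_iter_op/taylor_coef_sum/taylor_coef_rapid.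
have rone : rapid (fun k => (k == 0)%:R : R[i]).
  move=> r r0; exists 1 => -[|k]; first by rewrite cabs1 mul1r expr0.
  by rewrite cabs0 mul0r ler01.
have [one onec] := entire_of_rapid rone.
have onez z : one z = 1.
  apply: has_sum_unique (taylor_coef_sum one z) _; rewrite onec.
  have := @has_sum_finite R (fun k => (k == 0)%:R * z ^+ k) 1.
  rewrite big_ord1 mulr1; apply => -[//|k] _; by rewrite mul0r.
have close k : cabs (taylor_coef g k - (k == 0)%:R) <= 1 / 4.
  have := @taylor_coef_le R (-1 *: one + g) (1 / 16) k.
  rewrite taylor_coefD taylor_coefZ onec mulN1r [- _ + taylor_coef g k]addrC => H.
  apply: le_trans (H _) _; last lra.
  move=> x y xr yr; apply: le_trans (gone x y xr yr).
  have -> : (-1 *: one + g) (x +i* y)%C = -1 * one (x +i* y)%C + g (x +i* y)%C by [].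
  by rewrite onez mulN1r addrC.
set b := iter n _ _ in gc small rf.
have mub : cabs mu * coef_norm 1 b <= 5 / 4.
  have [->|mu0] := eqVneq mu 0; first by rewrite cabs0 mul0r; lra.
  have mu0' : 0 < cabs mu by rewrite cabs_gt0.
  rewrite -ler_pdivlMl //; apply: coef_norm_le => k.
  rewrite expr1n mulr1 ler_pdivlMl // -cabsM -gc.
  have : cabs (taylor_coef g k) <= cabs (taylor_coef g k - (k == 0)%:R) + cabs ((k == 0)%:R : R[i]).
    by have := cabsD (taylor_coef g k - (k == 0)%:R) (k == 0)%:R; rewrite subrK.
  have : cabs ((k == 0)%:R : R[i]) <= 1 by case: (k == 0); rewrite ?cabs1 ?cabs0 //; lra.
  by have := close k; lra.
have := close 0; rewrite gc eqxx cabs_distC => c0.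
have := cabs_triangle 1 (mu * b 0); rewrite cabs1 cabsM.
have := ler_wpM2l (cabs_ge0 mu) (small n); rewrite -/b.
by lra.
Qed.

Unset Implicit Arguments.

Theorem theorem5p5 (R : realType) (lambda : R[i]) (p : {poly R[i]})
    (hlambda : 1 < `|lambda|) (hp : (1 < size p)%N)
    (M : set (entire_fun R))
    (hMlin : linear_subspace M) (hMclosed : closed M)
    (hM : forall f : entire_fun R, M f -> f != 0 ->
       supercyclic (dilation lambda \o diff_poly p) f) :
  finite_dimensional M.
Proof.
have lambda_gt1 : 1 < cabs lambda by rewrite -ltcR -cabsE.
have [[N HN]|large] := pselect (exists N, forall f, M f -> vanish N (taylor_coef f) -> f = 0).
  apply: (@finite_dimensional_of_functionals _ _ (fun k f => taylor_coef f k) _ N) => //.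
  by move=> k l u v; rewrite taylor_coefD taylor_coefZ.
exfalso; have Mlarge N : exists f, [/\ M f, f != 0 & vanish N (taylor_coef f)].
  apply: contrapT => none; apply: large; exists N => f Mf vf.
  by apply: contrapT => /eqP f0; apply: none; exists f.
have [f [Mf f0 esc]] := block_series_escapes hp lambda_gt1 hMlin hMclosed Mlarge.
exact: not_supercyclic_of_small_constant_term esc (hM f Mf f0).
Qed.
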